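(* Let $\Omega\subset\mathbb{R}^2$ (with coordinates $x,y$) be a bounded convex set with nonempty interior, and let $\mathcal{U}_\Omega$ be the set of continuous concave functions $u$ on $\Omega$ with bounded gradient that vanish on $\partial\Omega$. (a) If at least one of the two vertical (that is, parallel to the $y$-axis) lines of support to $\Omega$ is not angular, then $$\sup_{u\in\mathcal{U}_\Omega,\ u\not\equiv 0}\ \frac{\int_\Omega u_x^2\,dx\,dy}{\int_\Omega u_y^2\,dx\,dy}=\infty .$$ (b) If both vertical lines of support to $\Omega$ are angular, then $$\sup_{u\in\mathcal{U}_\Omega,\ u\not\equiv 0}\ \frac{\int_\Omega u_x^2\,dx\,dy}{\int_\Omega u_y^2\,dx\,dy}<\infty .$$
   Context: Functions in $\mathcal{U}_\Omega$ are understood as continuous concave functions $u:\overline{\Omega}\to\mathbb{R}$ with $u=0$ on $\partial\Omega$. Such a function is differentiable almost everywhere; $u_x,u_y$ denote its partial derivatives and $\nabla u=(u_x,u_y)$. ''Bounded gradient'' means that $|\nabla u|$ is bounded over all points of differentiability. A point $\xi\in\partial\Omega$ is regular if there is exactly one line of support to $\Omega$ at $\xi$, and singular otherwise. The tangent cone to $\Omega$ at $\xi\in\partial\Omega$ is the closure of $\{\xi+t(p-\xi): p\in\Omega,\ t\ge 0\}$. A line of support $l$ to $\Omega$ is called angular if there is a singular point $\xi\in\partial\Omega$ such that $l$ meets the tangent cone to $\Omega$ at $\xi$ only at the vertex $\xi$. (Thus a line of support that is tangent to $\Omega$ at a regular point, or that is half-tangent at a singular point, i.e. contains a side of the tangent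 cone there, is not angular.) *)

(* Defs.v *)
(* MathComp-Analysis. *)
From HB Require Import structures.
From mathcomp Require Export all_boot all_order all_algebra.
From mathcomp Require Export all_classical all_reals all_analysis.

Set Implicit Arguments.
Unset Strict Implicit.
Unset Printing Implicit Defensive.

Export Order.TTheory GRing.Theory Num.Theory.
Export numFieldNormedType.Exports.

Local Open Scope classical_set_scope.
Local Open Scope ring_scope.

Definition boundary (T : topologicalType) (A : set T) : set T :=
  closure A `\` A°.

Definition line (R : realType) (a b c : R) : set (R * R) :=
  [set p | a * p.1 + b * p.2 = c].

Definition vertical_line (R : realType) (c : R) : set (R * R) :=
  [set p | p.1 = c].

(* Changing the signs of a, b and c keeps the line and swaps its sides, so
   the inequality below covers both sides. *)
Definition support_line (R : realType) (Omega l : set (R * R)) : Prop :=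
  exists a b c : R,
    [/\ (a, b) != (0, 0),
        l = line a b c,
        (forall p, Omega p -> a * p.1 + b * p.2 <= c) &
        l `&` closure Omega !=set0].

Definition regular_point (R : realType) (Omega : set (R * R))
    (xi : R * R) : Prop :=
  boundary Omega xi /\
  exists! l : set (R * R), support_line Omega l /\ l xi.

Definition singular_point (R : realType) (Omega : set (R * R))
    (xi : R * R) : Prop :=
  boundary Omega xi /\ ~ regular_point Omega xi.

Definition tangent_cone (R : realType) (Omega : set (R * R))
    (xi : R * R) : set (R * R) :=
  closure [set q | exists p t, [/\ Omega p, 0 <= t & q = xi + t *: (p - xi)]].

Definition angular (R : realType) (Omega l : set (R * R)) : Prop :=
  support_line Omega l /\
  exists2 xi, singular_point Omega xi &
    l `&` tangent_cone Omega xi = [set xi].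

(* ['D_v u p] carries no information where the derivative does not exist; for a
   concave u this happens only on a null set of interior points. *)
Definition partial_x (R : realType) (u : R * R -> R) (p : R * R) : R :=
  'D_(1, 0) u p.

Definition partial_y (R : realType) (u : R * R -> R) (p : R * R) : R :=
  'D_(0, 1) u p.

(* Only the values of u on the closure of Omega matter. *)
Definition admissible (R : realType) (Omega : set (R * R))
    (u : R * R -> R) : Prop :=
  [/\ {within closure Omega, continuous u},
      convex_function (closure Omega) (fun p => - u p),
      (forall p, boundary Omega p -> u p = 0) &
      exists M : R, forall p, Omega° p -> differentiable u p ->
        Num.sqrt (partial_x u p ^+ 2 + partial_y u p ^+ 2) <= M].

Definition lebesgue2 (R : realType) :=
  (@lebesgue_measure R \x @lebesgue_measure R)%E.

HB.instance Definition _ (R : realType) := Measure.on (@lebesgue2 R).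

(* A convex set need not be Borel, but its boundary is a null set, so that the
   integral over Omega is the integral over its interior; a partial derivative
   at an interior point depends only on the values of u on Omega. *)
Definition energy_x (R : realType) (Omega : set (R * R))
    (u : R * R -> R) : \bar R :=
  (\int[@lebesgue2 R]_(p in Omega°) ((partial_x u p) ^+ 2)%:E)%E.

Definition energy_y (R : realType) (Omega : set (R * R))
    (u : R * R -> R) : \bar R :=
  (\int[@lebesgue2 R]_(p in Omega°) ((partial_y u p) ^+ 2)%:E)%E.

Definition sup_energy_ratio (R : realType) (Omega : set (R * R)) : \bar R :=
  ereal_sup [set (energy_x Omega u / energy_y Omega u)%E | u in
    [set u | admissible Omega u /\ exists2 p, Omega p & u p != 0]].

(* Main.v *)
Require Import Defs.
From mathcomp Require Import ring lra measurable_realfun.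

(* (b) Let xi and eta be the angular points on the left and on the right.
   Testing the tangent plane at p against xi and eta, where u vanishes, gives
   |u_x| <= u / d1 + u / d2 + K |u_y|, where d1, d2 are the horizontal distances
   from p to xi and eta and K bounds the slopes of the two tangent cones. On a
   vertical slice u ^ 2 <= l * int u_y ^ 2 as soon as the slice has length less
   than l, and the cones make this length at most a multiple of d1 and of d2;
   hence int (u / di) ^ 2 <= C int u_y ^ 2.

   (a) Take for u the cone over Omega with apex at an interior point a, i.e. one
   minus the gauge of the interior of Omega centred at a. Tangent planes of u are
   nonnegative on Omega and take the value 1 at a. If the line is not angular,
   there are points xi (on the line) and P of Omega with |P.2 - xi.2| much larger
   than |P.1 - xi.1|; let a tend to the boundary horizontally, at the height of
   the midpoint of xi and P. Testing the tangent planes at xi and P yields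
   u_y ^ 2 <= c + (8 / K ^ 2) u_x ^ 2 with c independent of a and K arbitrarily
   large, while horizontal slices near a show that int u_x ^ 2 tends to infinity
   (a logarithmic divergence). *)

Set Implicit Arguments.
Unset Strict Implicit.
Unset Printing Implicit Defensive.

Local Open Scope classical_set_scope.
Local Open Scope ring_scope.

(** * Boxes and slices of the plane *)

(** An admissible [u] need not have partial derivatives everywhere, and ['D_v u p] is a default
    value where they fail. On each axis-parallel slice the failures of a concave function are
    countable, so by Tonelli they form a null set, and all pointwise estimates are made almost
    everywhere. Existence of the two partials is enough for the tangent plane inequality, even
    against points of the closure such as xi and eta. The slice inequality
    [u ^ 2 <= l * int u_y ^ 2] is obtained by comparing the derivative with slopes of chords on a
    finite grid and refining the grid. In (a) the apex has the height of the midpoint of xi and P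
    because these two then lie at opposite heights [-Y] and [Y] relative to it: one test bounds
    [u_y] from above, the other from below. The logarithm comes from dyadic strips between the
    heights of the apex and of xi: near the height of the apex [Om] ends within a distance
    comparable to the vertical offset, so each strip gives the same amount, and an apex at distance
    [w / 2 ^ n] from the exit has [n] strips. *)

Ltac scale_mul := repeat match goal with
  |- context [@GRing.scale ?A ?B ?a ?b] => change (@GRing.scale A B a b) with (a * b)
  end.

Lemma pair_ext (T1 T2 : Type) (p q : T1 * T2) : p.1 = q.1 -> p.2 = q.2 -> p = q.
Proof. by case: p q => ? ? [? ?] /= -> ->. Qed.

Ltac pair_eq := apply: pair_ext => /=; scale_mul.

Lemma interior_boxP (R : realType) (A : set (R * R)) p :
  A° p <-> exists2 e : R, 0 < e &
    forall q, `|q.1 - p.1| < e -> `|q.2 - p.2| < e -> A q.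
Proof.
rewrite /interior /=; split.
  move/nbhs_ballP => -[e e0 eA]; exists e => // q h1 h2; apply: eA.
  by split; rewrite /ball /= distrC.
move=> [e e0 eA]; apply/nbhs_ballP; exists e => // q [h1 h2].
by apply: eA; rewrite distrC.
Qed.

Lemma closure_boxP (R : realType) (A : set (R * R)) p :
  closure A p <-> forall e : R, 0 < e ->
    exists2 q, A q & `|q.1 - p.1| < e /\ `|q.2 - p.2| < e.
Proof.
split.
  move=> cA e e0; have [q [Aq [h1 h2]]] := cA _ (nbhsx_ballx p e e0).
  by exists q => //; split; rewrite distrC.
move=> h B /nbhs_ballP[e e0 eB]; have [q Aq [h1 h2]] := h e e0.
exists q; split => //; apply: eB; split; rewrite /ball /= distrC; [exact: h1|exact: h2].
Qed.

(** An open set is the union of the boxes with rational centre and half-width that it contains;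
    these are countably many products of measurable balls. *)
Lemma open_measurable2 (R : realType) (A : set (R * R)) : open A -> measurable A.
Proof.
move=> oA.
pose box (c : (rat * rat) * rat) : set (R * R) :=
  ball (ratr c.1.1 : R) (ratr c.2 : R) `*` ball (ratr c.1.2 : R) (ratr c.2 : R).
pose F c : set (R * R) := if pselect (box c `<=` A) then box c else set0.
have -> : A = \bigcup_c F c.
  apply/seteqP; split => p; last first.
    by move=> [c _]; rewrite /F; case: pselect => // sub; exact: sub.
  move=> Ap; have /interior_boxP[e e0 eA] : A° p by move/interior_id : oA => ->.
  have e4 : 0 < e / 4 by lra.
  have e42 : e / 4 < e / 2 by lra.
  (* A half-width above [e / 4], with a centre closer than [e / 4], makes the box contain [p]; a
     half-width below [e / 2] keeps the box within distance [e] of [p]. *)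
  have [r] := rat_in_itvoo e42; rewrite in_itv /= => /andP[r1 r2].
  have approx (x : R) : exists a : rat, `|x - (ratr a : R)| < e / 4.
    have /rat_in_itvoo[a] : x - e / 4 < x + e / 4 by lra.
    rewrite in_itv /= => /andP[h1 h2]; exists a; rewrite ltr_norml; apply/andP; split; lra.
  have [a ha] := approx p.1; have [b hb] := approx p.2.
  exists ((a, b), r) => //; rewrite /F; case: pselect => /= [?|].
    by split => /=; rewrite /ball /= distrC; [exact: lt_trans ha r1|exact: lt_trans hb r1].
  case=> q [/=]; rewrite /ball /= => h1 h2; apply: eA.
    move: ha h1; rewrite !ltr_norml => /andP[? ?] /andP[? ?]; apply/andP; split; lra.
  move: hb h2; rewrite !ltr_norml => /andP[? ?] /andP[? ?]; apply/andP; split; lra.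
apply: countable_bigcupT_measurable => [|c].
  exact: countableP.
rewrite /F; case: pselect => ? /=; last exact: measurable0.
by apply: measurableX; exact: measurable_ball.
Qed.

Section slices.
Variable R : realType.
Implicit Types (p : R * R) (A : set (R * R)).

(* [b] tells which coordinate moves with [t]: the first if [b], else the second. *)
Definition pt (b : bool) (s t : R) : R * R := if b then (t, s) else (s, t).

Lemma measurable_pt b s : measurable_fun [set: R] (pt b s).
Proof. by case: b; apply: measurable_fun_pair; (exact: measurable_id || exact: measurable_cst). Qed.

Lemma measurable_slice A b s : measurable A -> measurable [set t | A (pt b s t)].
Proof. by move=> mA; rewrite -[X in measurable X]setTI; exact: measurable_pt. Qed.

Lemma measurable_fun_slice A b s (F : R * R -> \bar R) : measurable A ->
  measurable_fun A F ->
  measurable_fun [set t | A (pt b s t)] (fun t => F (pt b s t)).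
Proof.
move=> mA mF; apply: (measurable_comp mA) => //; first by move=> _ [t At <-].
exact: measurable_funS (measurable_pt b s).
Qed.

Definition slice_integral A b (F : R * R -> \bar R) s : \bar R :=
  (\int[lebesgue_measure]_(t in [set t | A (pt b s t)]) F (pt b s t))%E.

(** Tonelli's theorem for [F] extended by zero off [A]; the flag [b] covers both orders of
    integration. *)
Lemma integral_slices A b (F : R * R -> \bar R) : measurable A ->
  measurable_fun A F -> (forall p, A p -> 0 <= F p)%E ->
  measurable_fun setT (slice_integral A b F) /\
  (\int[@lebesgue2 R]_(p in A) F p = \int[lebesgue_measure]_s slice_integral A b F s)%E.
Proof.
move=> mA mF F0.
have mG : measurable_fun setT (F \_ A) by apply/(measurable_restrictT _ mA).
have G0 p : (0 <= (F \_ A) p)%E by rewrite patchE; case: ifPn => // /set_mem/F0.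
have E s : slice_integral A b F s = (\int[lebesgue_measure]_t (F \_ A) (pt b s t))%E.
  rewrite /slice_integral integral_mkcond; apply: eq_integral => t _.
  rewrite !patchE; have [h|h] := pselect (A (pt b s t)).
    by rewrite !mem_set.
  by rewrite !memNset.
have -> : slice_integral A b F = fun s => (\int[lebesgue_measure]_t (F \_ A) (pt b s t))%E.
  by apply/funext.
rewrite integral_mkcond; case: b {E}.
  split; first exact: (measurable_fun_fubini_tonelli_G (m1 := @lebesgue_measure R)).
  exact: (fubini_tonelli2 (m1 := @lebesgue_measure R) (m2 := @lebesgue_measure R)).
split; first exact: (measurable_fun_fubini_tonelli_F (m2 := @lebesgue_measure R)).
exact: (fubini_tonelli1 (m1 := @lebesgue_measure R) (m2 := @lebesgue_measure R)).
Qed.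

End slices.

(** * One-sided derivatives of concave functions *)

Section concave1.
Variable R : realType.
Implicit Types (I : set R) (f : R -> R).

Definition concave1 I f := forall x y t, I x -> I y -> 0 <= t <= 1 ->
  f x + t * (f y - f x) <= f (x + t * (y - x)).

Lemma concave1_chord I f a b c : concave1 I f -> I a -> I c -> a < b -> b < c ->
  (f c - f b) * (b - a) <= (f b - f a) * (c - b).
Proof.
move=> cf Ia Ic ab bc; have ca : 0 < c - a by lra.
have ht : 0 <= (b - a) / (c - a) <= 1.
  by rewrite divr_ge0 ?(ltW ca) ?subr_ge0 ?(ltW ab) //= ler_pdivrMr // mul1r lerD2r ltW.
have := cf _ _ _ Ia Ic ht; have -> : a + (b - a) / (c - a) * (c - a) = b.
  by rewrite divfK ?gt_eqF // addrC subrK.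
rewrite -(ler_pM2r ca) mulrDl mulrAC divfK ?gt_eqF //; nra.
Qed.

Definition diffq f t h := h^-1 * (f (t + h) - f t).

(** Over the common denominator [h1 * h2] this is the three-point chord inequality; the signs of
    [h1] and [h2] decide which of [t], [t + h1], [t + h2] is the middle point. *)
Lemma diffq_noninc I f t h1 h2 : concave1 I f -> I t -> I (t + h1) -> I (t + h2) ->
  h1 < h2 -> h1 != 0 -> h2 != 0 -> diffq f t h2 <= diffq f t h1.
Proof.
move=> cf It I1 I2 h12 h10 h20; rewrite -subr_ge0.
have -> : diffq f t h1 - diffq f t h2 =
   (h2 * (f (t + h1) - f t) - h1 * (f (t + h2) - f t)) / (h1 * h2).
  by rewrite /diffq; field; rewrite h10 h20.
have [p1|n1|e1] := ltrgtP 0 h1; last by rewrite -e1 eqxx in h10.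
  have p2 := lt_trans p1 h12.
  apply: divr_ge0; last by rewrite mulr_ge0 ?ltW.
  have := concave1_chord cf It I2 (ltac:(lra) : t < t + h1) (ltac:(lra) : t + h1 < t + h2); nra.
have [p2|n2|e2] := ltrgtP 0 h2; last by rewrite -e2 eqxx in h20.
  rewrite -[X in 0 <= X]mulrNN -invrN; apply: mulr_ge0; rewrite ?invr_ge0; last by nra.
  have := concave1_chord cf I1 I2 (ltac:(lra) : t + h1 < t) (ltac:(lra) : t < t + h2); nra.
apply: divr_ge0; last by nra.
have := concave1_chord cf I1 It (ltac:(lra) : t + h1 < t + h2) (ltac:(lra) : t + h2 < t); nra.
Qed.

Definition rderiv f t := lim (diffq f t h @[h --> 0^'+]).
(** Defined by reflection, so that facts about left derivatives follow from those about right
    derivatives. *)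
Definition lderiv f t := - rderiv (f \o -%R) (- t).

Lemma open_ball1 I t : open I -> I t ->
  exists2 r : R, 0 < r & forall x, `|x - t| < r -> I x.
Proof.
move=> oI It; have /nbhs_ballP[r r0 h] : nbhs t I by apply: open_nbhs_nbhs.
by exists r => // x xr; apply: h; rewrite /ball /= distrC.
Qed.

Lemma rderiv_cvg I f t : open I -> concave1 I f -> I t ->
  diffq f t h @[h --> 0^'+] --> rderiv f t.
Proof.
move=> oI cf It; have [r r0 rI] := open_ball1 oI It.
have Ih h : `|h| < r -> I (t + h) by move=> hr; apply: rI; rewrite addrC addKr.
suff: cvg (diffq f t h @[h --> 0^'+]) by [].
apply: nonincreasing_at_right_is_cvgr.
  near=> x; move=> h1 h2; rewrite !in_itv /= => /andP[h10 h1x] /andP[h20 h2x].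
  have xr : x < r by near: x; exact: nbhs_right_lt.
  rewrite le_eqVlt => /predU1P[->//|h12].
  apply: (diffq_noninc cf It) => //; rewrite ?gt_eqF //; apply: Ih; rewrite gtr0_norm //; lra.
(* By monotonicity the quotient at one negative increment bounds all quotients at positive
   increments. *)
near=> x; exists (diffq f t (- (r / 2))); move=> _ [h /= hh <-]; move: hh; rewrite in_itv /= => /andP[h0 hx].
have xr : x < r by near: x; exact: nbhs_right_lt.
apply: (diffq_noninc cf It); rewrite ?oppr_eq0 ?gt_eqF //; try lra.
- by apply: Ih; rewrite normrN gtr0_norm; lra.
- by apply: Ih; rewrite gtr0_norm; lra.
Unshelve. all: by end_near. Qed.

Lemma concave1N I f : concave1 I f -> concave1 (-%R @^-1` I) (f \o -%R).
Proof.
by move=> cf x y t Ix Iy ht /=; have := cf _ _ _ Ix Iy ht; congr (_ <= f _); ring.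
Qed.

Lemma open_oppr I : open I -> open (-%R @^-1` I).
Proof. by move=> oI; apply: open_comp => // x _; exact: opp_continuous. Qed.

Lemma diffqN f t h : diffq (f \o -%R) (- t) h = - diffq f t (- h).
Proof. by rewrite /diffq /= opprD !opprK invrN mulNr opprK. Qed.

Lemma lderiv_cvg I f t : open I -> concave1 I f -> I t ->
  diffq f t h @[h --> 0^'-] --> lderiv f t.
Proof.
move=> oI cf It; apply/cvg_at_leftNP; rewrite oppr0.
have H : diffq (f \o -%R) (- t) h @[h --> 0^'+] --> rderiv (f \o -%R) (- t).
  by apply: (rderiv_cvg (open_oppr oI) (concave1N cf)); rewrite /= opprK.
have -> : diffq f t \o -%R = \- (diffq (f \o -%R) (- t)).
  by apply/funext => h; rewrite /= diffqN opprK.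
exact: cvgN.
Qed.

Lemma rderiv_ge I f t z : open I -> concave1 I f -> I t -> I z -> t < z ->
  diffq f t (z - t) <= rderiv f t.
Proof.
move=> oI cf It Iz tz; have [r r0 rI] := open_ball1 oI It.
apply: (cvgr_to_ge (rderiv_cvg oI cf It)); near=> h.
have h0 : 0 < h by near: h; exact: nbhs_right_gt.
have hr : h < r by near: h; exact: nbhs_right_lt.
have hz : h < z - t by near: h; apply: nbhs_right_lt; rewrite subr_gt0.
apply: (diffq_noninc cf It); rewrite ?gt_eqF //; try lra.
- by apply: rI; rewrite addrC addKr gtr0_norm.
- by rewrite addrC subrK.
Unshelve. all: by end_near. Qed.

Lemma lderiv_le I f t z : open I -> concave1 I f -> I t -> I z -> z < t ->
  lderiv f t <= diffq f t (z - t).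
Proof.
move=> oI cf It Iz zt.
have := @rderiv_ge _ (f \o -%R) (- t) (- z) (open_oppr oI) (concave1N cf).
rewrite /= !opprK ltrN2 => /(_ It Iz zt); rewrite /lderiv.
have -> : z - t = - (- z + t) by ring. by rewrite diffqN lerNl.
Qed.

Lemma rderiv_le_lderiv I f t : open I -> concave1 I f -> I t ->
  rderiv f t <= lderiv f t.
Proof.
move=> oI cf It; have [r r0 rI] := open_ball1 oI It.
have H h : 0 < h -> h < r -> diffq f t h <= lderiv f t.
  move=> h0 hr; apply: (cvgr_to_ge (lderiv_cvg oI cf It)); near=> k.
  have k0 : k < 0 by near: k; exact: nbhs_left_lt.
  have kr : - r < k by near: k; apply: nbhs_left_gt; rewrite oppr_lt0.
  apply: (diffq_noninc cf It); rewrite ?(gt_eqF h0) ?(lt_eqF k0) //; try lra.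
  - by apply: rI; rewrite addrC addKr ltr0_norm //; lra.
  - by apply: rI; rewrite addrC addKr gtr0_norm.
apply: (cvgr_to_le (rderiv_cvg oI cf It)); near=> h.
by apply: H; near: h; [exact: nbhs_right_gt|exact: nbhs_right_lt].
Unshelve. all: by end_near. Qed.

Lemma diffq_cvgP I f t : open I -> concave1 I f -> I t ->
  cvg (diffq f t h @[h --> 0^']) <-> rderiv f t = lderiv f t.
Proof.
move=> oI cf It; split=> [/cvg_ex[l hl]|e].
  have e1 : rderiv f t = l.
    by apply: cvg_lim => //; exact: cvg_dnbhs_at_right.
  have e2 : lderiv f t = l.
    rewrite -(cvg_lim _ (lderiv_cvg oI cf It)) //.
    by apply: cvg_lim => //; exact: cvg_dnbhs_at_left.
  by rewrite e1 e2.
have A := rderiv_cvg oI cf It.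
have B := lderiv_cvg oI cf It; rewrite -e in B.
apply/cvg_ex; exists (rderiv f t); apply/cvgrPdist_lt => eps e0.
move/cvgrPdist_lt : A => /(_ _ e0); move/cvgrPdist_lt : B => /(_ _ e0).
rewrite !near_withinE => nL nR; near=> h => hn0.
have [lt|gt|e0h] := ltrgtP h 0; last by rewrite e0h eqxx in hn0.
  by move: lt; near: h.
by move: gt; near: h.
Unshelve. all: by end_near. Qed.

Lemma diffq_lim I f t : open I -> concave1 I f -> I t ->
  cvg (diffq f t h @[h --> 0^']) -> lim (diffq f t h @[h --> 0^']) = rderiv f t.
Proof.
move=> oI cf It h; apply/esym; apply: cvg_lim => //.
exact: cvg_dnbhs_at_right.
Qed.

(* A point of non-differentiability carries the open interval between the two
   one-sided derivatives; these intervals are pairwise disjoint. *)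
Lemma countable_nondiff I f : open I -> concave1 I f ->
  countable [set t | I t /\ rderiv f t <> lderiv f t].
Proof.
move=> oI cf.
pose g t : rat := xget 0 [set q : rat | rderiv f t < ratr q < lderiv f t].
have gP t : I t -> rderiv f t <> lderiv f t -> rderiv f t < ratr (g t) < lderiv f t.
  move=> It /eqP ne; have lt : rderiv f t < lderiv f t.
    by rewrite lt_neqAle ne (rderiv_le_lderiv oI cf It).
  have [q] := rat_in_itvoo lt; rewrite in_itv /= => hq.
  by rewrite /g; case: xgetP => [_ -> //|/(_ q)].
apply/countable_injP; exists (pickle \o g).
(* For [t1 < t2] the slope of the chord lies above [lderiv f t2] and below [rderiv f t1], so the two
   intervals share no rational. *)
have key t1 t2 : I t1 -> I t2 -> rderiv f t1 <> lderiv f t1 ->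
    rderiv f t2 <> lderiv f t2 -> g t1 = g t2 -> ~ t1 < t2.
  move=> I1 I2 n1 n2 e lt; have /andP[h1 _] := gP _ I1 n1; have /andP[_ h2] := gP _ I2 n2.
  have h3 := rderiv_ge oI cf I1 I2 lt; have h4 := lderiv_le oI cf I2 I1 lt.
  have e34 : diffq f t1 (t2 - t1) = diffq f t2 (t1 - t2).
    have h : t2 - t1 != 0 by rewrite subr_eq0 gt_eqF.
    by rewrite /diffq !(addrC _ (_ - _)) !subrK -(opprB t2 t1); field.
  by move: h1 h2; rewrite e; lra.
move=> t1 t2 /set_mem[I1 n1] /set_mem[I2 n2] /= /(pcan_inj pickleK) e.
have [lt|lt|//] := ltrgtP t1 t2; first by case: (key _ _ I1 I2 n1 n2 e).
by case: (key _ _ I2 I1 n2 n1 (esym e)).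
Qed.

Lemma rderiv_supergradient I f t z : open I -> concave1 I f -> I t -> I z ->
  rderiv f t = lderiv f t -> f z <= f t + rderiv f t * (z - t).
Proof.
move=> oI cf It Iz e; have ez : t + (z - t) = z by ring.
have [lt|lt|<-] := ltrgtP t z; last by rewrite subrr mulr0 addr0.
  have := rderiv_ge oI cf It Iz lt.
  by rewrite /diffq ez mulrC ler_pdivrMr ?subr_gt0 //; lra.
have := lderiv_le oI cf It Iz lt; rewrite -e.
by rewrite /diffq ez mulrC ler_ndivlMr ?subr_lt0 //; lra.
Qed.

End concave1.

(** * Partial derivatives of concave functions of two variables *)

Section concave2.
Variable R : realType.
Implicit Types (p q : R * R) (C Om : set (R * R)) (u U : R * R -> R).

Definition convex2 C := forall p q t, C p -> C q -> 0 <= t <= 1 -> C (p + t *: (q - p)).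

Definition concave2 C u := forall p q t, C p -> C q -> 0 <= t <= 1 ->
  u p + t * (u q - u p) <= u (p + t *: (q - p)).

Definition dir (b : bool) : R * R := pt b 0 1.

Definition slice_set Om b s : set R := [set t | Om (pt b s t)].

Definition slice_fun u b s : R -> R := fun t => u (pt b s t).

Lemma continuous_pt b s : continuous (pt b s : R -> R * R).
Proof.
move=> t; case: b.
  apply: (@cvg_pair _ _ _ (nbhs t) (nbhs t) (nbhs s) _ _ _ id (cst s)).
    exact: cvg_id.
  exact: cvg_cst.
apply: (@cvg_pair _ _ _ (nbhs t) (nbhs s) (nbhs t) _ _ _ (cst s) id).
  exact: cvg_cst.
exact: cvg_id.
Qed.

Lemma open_slice Om b s : open Om -> open (slice_set Om b s).
Proof. by move=> oOm; apply: open_comp => // t _; exact: continuous_pt. Qed.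

Lemma pt_conv b s x y t : pt b s (x + t * (y - x)) = pt b s x + t *: (pt b s y - pt b s x) :> R * R.
Proof. by case: b; pair_eq; ring. Qed.

Lemma concave_slice Om u b s : concave2 Om u ->
  concave1 (slice_set Om b s) (slice_fun u b s).
Proof.
by move=> cu x y t Ix Iy ht; rewrite /slice_fun pt_conv; exact: cu.
Qed.

Lemma derive_slice u b s t :
  (fun h : R => h^-1 *: ((u \o shift (pt b s t)) (h *: dir b) - u (pt b s t))) =
  diffq (slice_fun u b s) t.
Proof.
apply/funext => h; rewrite /diffq /slice_fun /=; scale_mul.
by congr (_ * (u _ - _)); case: b; pair_eq; ring.
Qed.

Definition fixc (b : bool) p : R := if b then p.2 else p.1.
Definition movc (b : bool) p : R := if b then p.1 else p.2.

Lemma pt_coord b p : pt b (fixc b p) (movc b p) = p.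
Proof. by case: b; case: p. Qed.

Definition rd u b p := rderiv (slice_fun u b (fixc b p)) (movc b p).
Definition ld u b p := lderiv (slice_fun u b (fixc b p)) (movc b p).

Section fixed.
Variables (Om : set (R * R)) (u : R * R -> R) (b : bool).
Hypotheses (oOm : open Om) (cu : concave2 Om u) (ctu : continuous u).

Lemma slice_coord p : Om p -> slice_set Om b (fixc b p) (movc b p).
Proof. by rewrite /slice_set /= pt_coord. Qed.

Lemma derivable_slice p : Om p -> derivable u p (dir b) <-> rd u b p = ld u b p.
Proof.
move=> Op; have := derive_slice u b (fixc b p) (movc b p).
rewrite pt_coord /derivable => ->.
exact: (diffq_cvgP (open_slice oOm) (concave_slice cu) (slice_coord Op)).
Qed.

Lemma derive_rd p : Om p -> derivable u p (dir b) -> 'D_(dir b) u p = rd u b p.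
Proof.
move=> Op; have := derive_slice u b (fixc b p) (movc b p).
rewrite pt_coord /derivable /derive => ->.
exact: (diffq_lim (open_slice oOm) (concave_slice cu) (slice_coord Op)).
Qed.

(** [lim] of a non-convergent filter is the default [point]. The derivative is thus constant on the
    exceptional set, which makes it measurable on the whole open set. *)
Lemma nonderivable_derive p : ~ derivable u p (dir b) -> 'D_(dir b) u p = point.
Proof.
move=> nd; rewrite /derive /lim /lim_in; apply: getPN => l hl.
by apply: nd; rewrite /derivable; apply/cvg_ex; exists l.
Qed.

(** * Measurability of the partial derivatives; the exceptional set is null *)

Lemma continuous_measurable2 : measurable_fun setT u.
Proof.
apply: (measurability _ (RGenOpens.measurableE R)) => _ [_ [a [c ->] <-]].
rewrite setTI; apply: open_measurable2; apply: open_comp => // x _; exact: ctu.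
Qed.

Lemma measurable_shift (w : R * R) : measurable_fun setT (fun p => u (p + w)).
Proof.
apply: (@measurableT_comp _ _ _ _ _ _ u _ (fun p : R * R => p + w)).
  exact: continuous_measurable2.
apply/measurable_fun_pairP; split => /=.
  by apply: measurable_funD => //; exact: measurable_fst.
by apply: measurable_funD => //; exact: measurable_snd.
Qed.

Lemma measurable_diffq (c : R) :
  measurable_fun setT (fun p => diffq (slice_fun u b (fixc b p)) (movc b p) c).
Proof.
have -> : (fun p => diffq (slice_fun u b (fixc b p)) (movc b p) c) =
    (fun p => c^-1 * (u (p + c *: dir b) - u p)).
  apply/funext => p; rewrite /diffq /slice_fun pt_coord.
  by congr (_ * (u _ - _)); rewrite -{3}(pt_coord b p); case: b; pair_eq; ring.
apply: measurable_funM => //; apply: measurable_funB.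
  exact: measurable_shift.
exact: continuous_measurable2.
Qed.

(** A pointwise limit of measurable difference quotients, along the increments [1 / (n + 1)]. *)
Lemma measurable_rd : measurable_fun Om (rd u b).
Proof.
apply: (@measurable_fun_cvg _ _ _ _ (fun n p =>
    diffq (slice_fun u b (fixc b p)) (movc b p) (harmonic n))).
  by move=> n; apply: measurable_funTS; exact: measurable_diffq.
move=> p Op.
have /cvg_at_rightP := rderiv_cvg (open_slice oOm) (concave_slice cu) (slice_coord Op).
by apply; split => [n|]; [exact: harmonic_gt0|exact: cvg_harmonic].
Qed.

Lemma measurable_ld : measurable_fun Om (ld u b).
Proof.
apply: (@measurable_fun_cvg _ _ _ _ (fun n p =>
    diffq (slice_fun u b (fixc b p)) (movc b p) (- harmonic n))).
  by move=> n; apply: measurable_funTS; exact: measurable_diffq.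
move=> p Op.
have /cvg_at_leftP := lderiv_cvg (open_slice oOm) (concave_slice cu) (slice_coord Op).
apply; split => [n|]; first by rewrite oppr_lt0 harmonic_gt0.
by rewrite -[X in _ --> X]oppr0; apply: cvgN; exact: cvg_harmonic.
Qed.

Definition nonderivable : set (R * R) := [set p | Om p /\ ~ derivable u p (dir b)].

Lemma measurable_nonderivable : measurable nonderivable.
Proof.
have -> : nonderivable = Om `&` (rd u b \- ld u b) @^-1` (~` [set 0]).
  apply/seteqP; split => p [Op h]; split => //= h'; apply: h.
    by apply/(derivable_slice Op)/eqP; rewrite -subr_eq0; apply/eqP.
  by have /= -> := (derivable_slice Op).1 h'; rewrite subrr.
have mOm : measurable Om by exact: open_measurable2.
apply: (measurable_funB measurable_rd measurable_ld mOm).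
by apply: measurableC; exact: measurable_set1.
Qed.

Lemma countable_slice_nonderivable s : countable [set t | nonderivable (pt b s t)].
Proof.
apply: sub_countable (countable_nondiff (@open_slice Om b s oOm) (@concave_slice Om u b s cu)).
apply: subset_card_le => t [Ot nd]; split => // e; apply: nd.
apply/(derivable_slice Ot); rewrite /rd /ld.
by move: e; case: b.
Qed.

(** Tonelli in the direction of differentiation: every slice of the set is countable. *)
Lemma nonderivable_null : @lebesgue2 R nonderivable = 0%E.
Proof.
have mN := measurable_nonderivable.
rewrite -[RHS](mul0e 0%E) -[LHS]mul1e -integral_cst //.
have [_ ->] := @integral_slices R nonderivable b (cst 1%E) mN (measurable_cst _) (fun _ _ => lee01).
rewrite mul0e; apply: integral0_eq => s _; rewrite /slice_integral.
rewrite integral_cst ?mul1e; last exact: measurable_slice.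
exact: countable_lebesgue_measure0 (countable_slice_nonderivable s).
Qed.

Lemma measurable_derive : measurable_fun Om ('D_(dir b) u).
Proof.
have mOm : measurable Om by exact: open_measurable2.
have mN := measurable_nonderivable.
pose F p := if p \in nonderivable then (point : R) else rd u b p.
apply: (@eq_measurable_fun _ _ _ _ _ F).
  move=> p /set_mem Op; rewrite /F; case: ifPn => [/set_mem[_ nd]|nN].
    by rewrite nonderivable_derive.
  apply/esym/derive_rd => //; apply: contrapT => nd.
  by move/negP : nN; apply; apply/mem_set.
apply: measurable_fun_if => //.
- apply: (@measurable_fun_bool _ _ _ _ true).
  rewrite (_ : _ @^-1` _ = nonderivable); first exact: measurableI.
  by apply/seteqP; split => p /=; [move/set_mem|move/mem_set].
- by apply: measurable_funS measurable_rd => // p [].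
Qed.

End fixed.
End concave2.

(** * Lower bounds for one-dimensional energies *)

Section lower_bounds.
Variable R : realType.
Local Notation mu := (@lebesgue_measure R).

(** The constant [k] may be negative, as can happen for the bounds summed later; then the
    nonnegativity of [F] is enough. *)
Lemma integral_ge_cst (J N : set R) (F : R -> \bar R) (k m : R) :
  measurable J -> mu J = m%:E -> measurable_fun J F ->
  (forall t, J t -> 0 <= F t)%E -> countable N ->
  (forall t, J t -> ~ N t -> (k%:E <= F t)%E) ->
  ((k * m)%:E <= \int[mu]_(t in J) F t)%E.
Proof.
move=> mJ Jm mF F0 cN kF; have m0 : 0 <= m by rewrite -lee_fin -Jm.
have [k0|k0] := leP k 0.
  apply: (@le_trans _ _ 0%E); last exact: integral_ge0.
  by rewrite lee_fin mulr_le0_ge0.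
rewrite EFinM -Jm -integral_cst //; apply: ae_ge0_le_integral => //.
  by move=> t _; rewrite lee_fin ltW.
exists N; split.
- exact: countable_measurable.
- exact: countable_lebesgue_measure0.
- by move=> t /= h; apply: contrapT => nN; apply: h => Jt; exact: kF.
Qed.

Lemma integral_ge_sum (I : set R) (J : nat -> set R) (F : R -> \bar R) (k : nat -> R) n :
  measurable I -> measurable_fun I F -> (forall t, I t -> 0 <= F t)%E ->
  (forall i, measurable (J i)) -> trivIset setT J ->
  (forall i, (i < n)%N -> J i `<=` I) ->
  (forall i, (i < n)%N -> ((k i)%:E <= \int[mu]_(t in J i) F t)%E) ->
  ((\sum_(i < n) k i)%:E <= \int[mu]_(t in I) F t)%E.
Proof.
move=> mI mF F0 mJ tJ JI kJ.
pose s := index_iota 0 n; pose D := \big[setU/set0]_(i <- s) J i.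
have DI : D `<=` I.
  rewrite /D /s => t; rewrite -bigcup_seq => -[i /=]; rewrite mem_index_iota => /andP[_ hi].
  exact: JI.
have mD : measurable D by exact: bigsetU_measurable.
apply: (@le_trans _ _ (\int[mu]_(t in D) F t)%E); last exact: ge0_subset_integral.
rewrite ge0_integral_bigsetU //.
- rewrite -sumEFin -(big_mkord xpredT (fun i => (k i)%:E)) big_seq [leRHS]big_seq.
  by apply: lee_sum => i; rewrite mem_index_iota => /andP[_ hi]; exact: kJ.
- exact: iota_uniq.
- by apply: sub_trivIset tJ.
- exact: measurable_funS mF.
- by move=> t /DI/F0.
Qed.

(** Dividing by [d] lets one formula serve both signs of [d]: the open interval between [e + k * d]
    and [e + (k + 1) * d], in whichever order they come. *)
Definition step (e d : R) (k : nat) : set R := [set t | k%:R < (t - e) / d < k.+1%:R].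

Lemma step_measure e d k : d != 0 -> measurable (step e d k) /\ mu (step e d k) = `|d|%:E.
Proof.
move=> d0; have [d1|d1|d1] := ltrgtP 0 d; last by rewrite -d1 eqxx in d0.
  have -> : step e d k = `](e + k%:R * d), (e + k.+1%:R * d)[%classic.
    apply/seteqP; split => t; rewrite /step /= in_itv /= ltr_pdivlMr // ltr_pdivrMr //;
    by move=> /andP[h1 h2]; apply/andP; split; lra.
  split=> //; rewrite lebesgue_measure_itv /= lte_fin.
  have -> : e + k%:R * d < e + k.+1%:R * d by rewrite -natr1; lra.
  by rewrite gtr0_norm // -EFinD; congr (_%:E); rewrite -natr1; ring.
have -> : step e d k = `](e + k.+1%:R * d), (e + k%:R * d)[%classic.
  apply/seteqP; split => t; rewrite /step /= in_itv /= ltr_ndivlMr // ltr_ndivrMr //;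
  by move=> /andP[h1 h2]; apply/andP; split; lra.
split=> //; rewrite lebesgue_measure_itv /= lte_fin.
have -> : e + k.+1%:R * d < e + k%:R * d by rewrite -natr1; lra.
by rewrite ltr0_norm // -EFinD; congr (_%:E); rewrite -natr1; ring.
Qed.

Lemma trivIset_step e d : trivIset setT (step e d).
Proof.
apply/trivIsetP => i j _ _; wlog lt : i j / (i < j)%N.
  move=> H; rewrite neq_ltn => /orP[lt|lt]; first by apply: H => //; rewrite neq_ltn lt.
  by rewrite setIC; apply: H => //; rewrite neq_ltn lt.
move=> _; apply/seteqP; split => // t [/andP[_ h1] /andP[h2 _]].
have : (i.+1%:R : R) <= j%:R by rewrite ler_nat.
by move: (lt_trans h2 h1); rewrite ltNge => /negP.
Qed.

(* With [x_k] the equidistant points from [e] to [z], concavity bounds [D] on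
   the k-th step by the slope of the next chord, and
   [D ^+ 2 >= 2 * m * D - m ^+ 2] turns the sum of these bounds into a
   telescoping one, for [m] the slope of the chord from [e] to [z]. *)
Lemma concave_energy_ge (I : set R) (f D : R -> R) e d :
  open I -> concave1 I f -> continuous f -> measurable_fun I D ->
  (forall t, I t -> rderiv f t = lderiv f t -> D t = rderiv f t) ->
  d != 0 -> f e = 0 -> 0 <= f (e + d) ->
  (forall r, 0 < r <= 1 -> I (e + r * d)) ->
  ((f (e + d) ^+ 2 / `|d|)%:E <= \int[mu]_(t in I) ((D t) ^+ 2)%:E)%E.
Proof.
move=> oI cf ctf mD DP d0 fe fz Ir; set z := f (e + d).
have mI : measurable I by exact: open_measurable.
have mF : measurable_fun I (fun t => ((D t) ^+ 2)%:E).
  by apply/measurable_EFinP; exact: measurable_funX.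
have F0 t : I t -> (0 <= ((D t) ^+ 2)%:E)%E by rewrite lee_fin sqr_ge0.
have dn : 0 < `|d| by rewrite normr_gt0.
have dd : `|d| ^+ 2 = d ^+ 2 by rewrite real_normK // num_real.
(* The bound on a step looks one chord ahead, so only the first [n] of the [n + 1] steps are used
   and the telescoping sum keeps the value of [f] at the first grid point. This value tends to
   [f e = 0]. *)
suff H (n : nat) : (((z ^+ 2 - 2 * z * f (e + n.+1%:R^-1 * d)) / `|d|)%:E
    <= \int[mu]_(t in I) ((D t) ^+ 2)%:E)%E.
  move: H; case: (\int[mu]_(t in I) ((D t) ^+ 2)%:E)%E => [T H|_|/(_ 0%N)]; last 2 first.
  - by rewrite leey.
  - by rewrite leeNy_eq.
  rewrite lee_fin.
  have C : (fun n : nat => (z ^+ 2 - 2 * z * f (e + n.+1%:R^-1 * d)) / `|d|) @ \oo -->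
      (z ^+ 2 - 2 * z * f (e + 0 * d)) / `|d|.
    apply: cvgM; last exact: cvg_cst.
    apply: cvgB; first exact: cvg_cst.
    apply: cvgM; first exact: cvg_cst.
    apply: (@cvg_comp _ _ _ (fun n : nat => e + n.+1%:R^-1 * d) f); last exact: ctf.
    by apply: cvgD; [exact: cvg_cst|apply: cvgM; [exact: cvg_harmonic|exact: cvg_cst]].
  have := cvgr_to_le C; rewrite mul0r addr0 fe mulr0 subr0; apply.
  by apply: nearW => n; rewrite -lee_fin.
pose h := d / n.+1%:R; pose x k := e + k%:R * h; pose N : R := n.+1%:R.
have N0 : 0 < N by rewrite ltr0n.
have h0 : h != 0 by rewrite mulf_neq0 // invr_neq0 // gt_eqF.
have hN : h * N = d by rewrite /h divfK // gt_eqF.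
have hn : `|h| = `|d| / N by rewrite /h normrM normfV (gtr0_norm N0).
have Ix r : 0 < r <= N -> I (e + r * h).
  move=> /andP[r0 rN]; have -> : r * h = r / N * d by rewrite /h -/N; ring.
  by apply: Ir; rewrite divr_gt0 //= ler_pdivrMr // mul1r.
have EJ k t : step e h k t -> t = e + ((t - e) / h) * h by move=> _; field.
have JI k : (k < n)%N -> step e h k `<=` I.
  move=> kn t Jt; rewrite (EJ _ _ Jt); apply: Ix; case/andP: Jt => h1 h2.
  apply/andP; split; first exact: le_lt_trans h1.
  by apply/ltW/(lt_le_trans h2); rewrite ler_nat ltnS ltnW.
(* The grid point [x k.+1] lies at the fraction [1 / w] of the way from [x k.+2] to [t]. Concavity
   bounds [f (x k.+1)] from below there, and the supergradient at [t] bounds [f (x k.+2)] from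
   above. Multiplying by [h] avoids a case split on its sign. *)
have slope k t : (k < n)%N -> step e h k t -> rderiv f t = lderiv f t ->
    f (x k.+2) - f (x k.+1) <= D t * h.
  move=> kn Jt er; have It := JI _ kn _ Jt; rewrite (DP _ It er).
  set r := (t - e) / h; have /andP[r1 r2] : k%:R < r < k.+1%:R by [].
  have k2 : (k.+2%:R : R) <= N by rewrite ler_nat !ltnS.
  have k12 : (k.+2%:R : R) = k.+1%:R + 1 by rewrite natr1.
  have k0 : (0 : R) <= k%:R by [].
  have I2 : I (x k.+2) by apply: Ix; rewrite k2 andbT.
  have et : t = e + r * h by exact: EJ Jt.
  have S := rderiv_supergradient oI cf It I2 er.
  pose w := k.+2%:R - r; have w1 : 1 < w by rewrite /w; lra.
  have w0 : w != 0 by rewrite gt_eqF //; lra.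
  have ht : 0 <= 1 / w <= 1 by rewrite divr_ge0 ?ler_pdivrMr ?mul1r; lra.
  have := cf _ _ _ I2 It ht.
  have -> : x k.+2 + 1 / w * (t - x k.+2) = x k.+1.
    by move: w0; rewrite et /x /w k12; move: (k.+1%:R : R) => c c0; field.
  have ex : x k.+2 - t = w * h by rewrite et /x /w; ring.
  move: S; rewrite ex => S C.
  have {}S : f (x k.+2) - f t <= w * (rderiv f t * h) by lra.
  have {}C : 1 / w * (f (x k.+2) - f t) >= f (x k.+2) - f (x k.+1) by lra.
  apply: le_trans C _; rewrite mul1r ler_pdivrMl //; lra.
(* This is [2 * m * D - m ^+ 2] with [m = z / d] and [D] replaced by its bound, [1 / h] being
   [N / d]; the factor [|h|] is the length of the step. *)
pose K k := (2 * z / d ^+ 2 * N * (f (x k.+2) - f (x k.+1)) - z ^+ 2 / d ^+ 2) * `|h|.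
have d20 : 0 < d ^+ 2 by rewrite exprn_even_gt0.
have HK : ((\sum_(k < n) K k)%:E <= \int[mu]_(t in I) ((D t) ^+ 2)%:E)%E.
  apply: (@integral_ge_sum _ (step e h)) => //.
  - by move=> k; have [] := step_measure e k h0.
  - exact: trivIset_step.
  - move=> k kn; have [mJ Jm] := step_measure e k h0.
    apply: (integral_ge_cst (N := [set t | I t /\ rderiv f t <> lderiv f t])) => //.
    + by apply: measurable_funS mF => //; exact: JI.
    + by move=> t /(JI _ kn)/F0.
    + exact: countable_nondiff.
    + move=> t Jt nN; rewrite lee_fin.
      have er : rderiv f t = lderiv f t.
        by apply: contrapT => ne; apply: nN; split => //; exact: JI Jt.
      have S := slope _ _ kn Jt er.
      have : 2 * (z / d ^+ 2 * N) * (f (x k.+2) - f (x k.+1)) <= 2 * (z / d ^+ 2 * N) * (D t * h).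
        by rewrite ler_wpM2l // !mulr_ge0 // ?invr_ge0 ltW.
      have -> : 2 * (z / d ^+ 2 * N) * (D t * h) = 2 * (z / d) * D t.
        by rewrite -hN; field; rewrite h0 gt_eqF.
      have -> : z ^+ 2 / d ^+ 2 = (z / d) ^+ 2 by rewrite expr_div_n.
      have := sqr_ge0 (D t - z / d); nra.
apply: le_trans HK; rewrite lee_fin.
have -> : \sum_(k < n) K k =
    2 * z / `|d| * (z - f (x 1%N)) - n%:R / N * (z ^+ 2 / `|d|).
  rewrite -mulr_suml big_split /= sumrN -mulr_sumr.
  rewrite -(big_mkord xpredT (fun k => f (x k.+2) - f (x k.+1))).
  rewrite (telescope_sumr (fun k => f (x k.+1))) // sumr_const card_ord -[X in _ - X]mulr_natl.
  have -> : f (x n.+1) = z by rewrite /x mulrC hN.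
  by rewrite hn -dd; field; rewrite !gt_eqF.
have -> : e + n.+1%:R^-1 * d = x 1%N by rewrite /x mul1r /h mulrC.
have q : n%:R / N * (z ^+ 2 / `|d|) <= z ^+ 2 / `|d|.
  rewrite ler_piMl // ?divr_ge0 ?sqr_ge0 ?(ltW dn) //.
  by rewrite ler_pdivrMr // mul1r ler_nat.
have -> : (z ^+ 2 - 2 * z * f (x 1%N)) / `|d| =
   2 * z / `|d| * (z - f (x 1%N)) - z ^+ 2 / `|d| by ring.
by rewrite lerD2l lerN2.
Qed.

End lower_bounds.

(** * First exits, tangent planes, interiors of convex sets *)

Section plane.
Variable R : realType.
Implicit Types (p q : R * R) (A C Om : set (R * R)) (u U : R * R -> R).

Lemma open_segment_near Om p v : open Om -> Om p ->
  exists2 e : R, 0 < e & forall h, `|h| < e -> Om (p + h *: v).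
Proof.
move=> oOm Op; have /interior_boxP[e e0 eO] : Om° p by move/interior_id : oOm => ->.
pose M := `|v.1| + `|v.2| + 1.
have M0 : 0 < M by rewrite ltr_wpDl // addr_ge0.
exists (e / M); first exact: divr_gt0.
move=> h; rewrite ltr_pdivlMr // => hM.
have b x : `|x| <= M -> `|h * x| < e.
  by move=> xM; rewrite normrM; apply: le_lt_trans hM; exact: ler_wpM2l.
have v1 : `|v.1| <= M by rewrite /M; have := normr_ge0 v.2; lra.
have v2 : `|v.2| <= M by rewrite /M; have := normr_ge0 v.1; lra.
by apply: eO => /=; scale_mul; rewrite addrC addKr; exact: b.
Qed.

Lemma first_exit Om p q : open Om -> Om p -> ~ Om q ->
  exists r : R, [/\ 0 < r <= 1, ~ Om (p + r *: (q - p)) &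
    forall s, 0 <= s < r -> Om (p + s *: (q - p))].
Proof.
move=> oOm Op nOq; pose S : set R := [set r | 0 <= r <= 1 /\ ~ Om (p + r *: (q - p))].
have E1 : p + 1 *: (q - p) = q by pair_eq; ring.
have S1 : S 1 by rewrite /S /= E1 ler01 lexx.
have lS : lbound S 0 by move=> r [/andP[]].
have iS : has_inf S by split; [exists 1|exists 0].
have r0 : 0 <= inf S by apply: lb_le_inf => //; exists 1.
have r1 : inf S <= 1 by apply: ge_inf => //; exists 0.
have out : ~ Om (p + inf S *: (q - p)).
  move=> Oi; have [e e0 eO] := open_segment_near (q - p) oOm Oi.
  have [s Ss se] := inf_adherent e0 iS.
  have ls : inf S <= s by apply: ge_inf => //; exists 0.
  have := eO (s - inf S); rewrite ger0_norm ?subr_ge0 // => /(_ ltac:(lra)).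
  by case: Ss => _ nO; rewrite -addrA -scalerDl [inf S + _]addrC subrK => /nO.
exists (inf S); split => //.
  rewrite r1 andbT lt_neqAle r0 andbT; apply/eqP => e.
  by apply: out; rewrite -e scale0r addr0.
move=> s /andP[s0 si]; apply: contrapT => nO.
have Ss : S s by split => //; rewrite s0 /= (le_trans (ltW si)).
by have := ge_inf (ex_intro _ 0 lS) Ss; rewrite leNgt si.
Qed.

(** The one-dimensional estimate is run from the first exit point on the way from [z] to [w], where
    [U] vanishes, back to [z]; the outside point [w] only bounds the length of that segment. *)
Lemma slice_energy_ge Om U b s z w : open Om -> concave2 Om U -> continuous U ->
  (forall p, ~ Om p -> U p = 0) -> Om (pt b s z) -> ~ Om (pt b s w) ->
  0 <= U (pt b s z) ->
  ((U (pt b s z) ^+ 2 / `|z - w|)%:E <=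
   slice_integral Om b (fun p => (('D_(dir R b) U p) ^+ 2)%:E) s)%E.
Proof.
move=> oOm cU ctU U0 Oz nOw Uz.
have [r [/andP[r0 r1] nOe inO]] := first_exit oOm Oz nOw.
rewrite -pt_conv in nOe.
have zw : z - w != 0 by rewrite subr_eq0; apply/eqP => e; rewrite e in Oz.
pose d := r * (z - w); have d0 : d != 0 by rewrite mulf_neq0 // gt_eqF.
have ez : z + r * (w - z) + d = z by rewrite /d; ring.
have mD : measurable_fun (slice_set Om b s) (fun t => 'D_(dir R b) U (pt b s t)).
  have mOm : measurable Om by exact: open_measurable2.
  apply/measurable_EFinP; apply: (measurable_fun_slice (F := EFin \o 'D_(dir R b) U)) => //.
  by apply/measurable_EFinP; exact: measurable_derive.
have := @concave_energy_ge R (slice_set Om b s) (slice_fun U b s)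
  (fun t => 'D_(dir R b) U (pt b s t)) (z + r * (w - z)) d
  (@open_slice R Om b s oOm) (@concave_slice R Om U b s cU).
rewrite ez => H; apply: le_trans (H _ mD _ d0 (U0 _ nOe) Uz _).
- rewrite lee_fin ler_wpM2l ?sqr_ge0 // lef_pV2 ?posrE ?normr_gt0 //.
  by rewrite /d normrM (gtr0_norm r0) ler_piMl.
- move=> t; apply: (@continuous_comp _ _ _ (pt b s) U); first exact: continuous_pt.
  exact: ctU.
- move=> t It e; have E : rd U b (pt b s t) = ld U b (pt b s t).
    by rewrite /rd /ld; move: e; case: b {Oz nOw Uz nOe inO mD H It}.
  rewrite (derive_rd oOm cU It); last exact: (proj2 (@derivable_slice R Om U b oOm cU _ It)).
  by rewrite /rd; case: b {Oz nOw Uz nOe inO mD H It e E}.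
- move=> x /andP[x0 x1]; rewrite /slice_set /=.
  have -> : z + r * (w - z) + x * d = z + (r * (1 - x)) * (w - z) by rewrite /d; ring.
  rewrite pt_conv; apply: inO; rewrite mulr_ge0 ?subr_ge0 //=; last exact: ltW.
  by rewrite gtr_pMr //; lra.
Qed.

Lemma derivable_approx u p v (e : R) : derivable u p v -> 0 < e ->
  exists2 d : R, 0 < d & forall h, `|h| < d ->
    `|u (p + h *: v) - u p - h * 'D_v u p| <= e * `|h|.
Proof.
move=> du e0; have /cvgrPdist_le /(_ _ e0) : (fun h : R => h^-1 *: ((u \o shift p) (h *: v) - u p)) @ 0^' --> 'D_v u p.
  exact: du.
rewrite near_withinE => /nbhs_ballP[d d0 H]; exists d => // h hd.
have [->|h0] := eqVneq h 0; first by rewrite scale0r addr0 !subrr mul0r subrr normr0 mulr0.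
have := H h; rewrite /ball /= sub0r normrN => /(_ hd h0).
scale_mul; rewrite [h *: v + p]addrC => K.
have -> : u (p + h *: v) - u p - h * 'D_v u p = - (('D_v u p - h^-1 * (u (p + h *: v) - u p)) * h).
  by field.
by rewrite normrN normrM ler_wpM2r.
Qed.

(** With [v = q - p], the point [p - t * v] is the midpoint of two points reached from [p] along the
    axes, so the partial derivatives bound [u] there from below. As [p] lies between [p - t * v] and
    [q], concavity turns this into an upper bound at [q], up to an error that vanishes with [t]. *)
Lemma supergradient C Om u p q : open Om -> Om `<=` C -> concave2 C u -> Om p -> C q ->
  derivable u p (dir R true) -> derivable u p (dir R false) ->
  u q <= u p + 'D_(dir R true) u p * (q.1 - p.1) + 'D_(dir R false) u p * (q.2 - p.2).
Proof.
move=> oOm OC cu Op Cq dx dy; apply/ler_addgt0Pr => e e0.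
pose v := q - p; pose M := `|v.1| + `|v.2| + 1.
have M0 : 0 < M by rewrite ltr_wpDl // addr_ge0.
have eM : 0 < e / M by exact: divr_gt0.
have [d1 d10 H1] := derivable_approx dx eM.
have [d2 d20 H2] := derivable_approx dy eM.
have [d3 d30 H3] := open_segment_near (dir R true) oOm Op.
have [d4 d40 H4] := open_segment_near (dir R false) oOm Op.
have [d5 d50 H5] := open_segment_near v oOm Op.
pose d := Num.min d1 (Num.min d2 (Num.min d3 (Num.min d4 d5))).
have d0 : 0 < d by rewrite !lt_min d10 d20 d30 d40 d50.
(* Makes the displacements [2 * t * v.1], [2 * t * v.2] and [t] all smaller than [d]; the summand 1
   in [M] gives [t <= t * M]. *)
pose t := d / (4 * M).
have t0 : 0 < t by rewrite divr_gt0 // mulr_gt0.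
have tM : 2 * t * M < d.
  have -> : 2 * t * M = d / 2 by rewrite /t; field; rewrite gt_eqF.
  lra.
have b x : `|x| <= M -> `|- (2 * t * x)| < d.
  move=> xM; rewrite normrN normrM (gtr0_norm (mulr_gt0 _ t0)) //.
  by apply: le_lt_trans tM; rewrite ler_wpM2l // ltW // mulr_gt0.
have v1 : `|v.1| <= M by rewrite /M; have := normr_ge0 v.2; lra.
have v2 : `|v.2| <= M by rewrite /M; have := normr_ge0 v.1; lra.
have td : `|- t| < d.
  rewrite normrN gtr0_norm //; apply: le_lt_trans tM.
  have M1 : 1 <= M by rewrite /M; have := normr_ge0 v.1; have := normr_ge0 v.2; lra.
  have : t * 1 <= t * M by rewrite ler_wpM2l // ltW.
  by rewrite mulr1; have := mulr_gt0 t0 M0; lra.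
have bd x : x < d -> [/\ x < d1, x < d2, x < d3, x < d4 & x < d5].
  by rewrite !lt_min => /and5P[].
have [h11 h12 h13 h14 h15] := bd _ (b _ v1).
have [h21 h22 h23 h24 h25] := bd _ (b _ v2).
have [_ _ _ _ h35] := bd _ td.
clear bd b tM td; clearbody t d.
have C1 := OC _ (H3 _ h13); have C2 := OC _ (H4 _ h24); have C3 := OC _ (H5 _ h35).
have half : 0 <= (2^-1 : R) <= 1 by rewrite invr_ge0 ler0n invf_le1 // ler1n.
have K1 := cu _ _ _ C1 C2 half.
have t10 : 0 < 1 + t by lra.
have t1 : 0 <= t / (1 + t) <= 1.
  by rewrite divr_ge0 ?(ltW t0) ?(ltW t10) //= ler_pdivrMr // mul1r; lra.
have K2 := cu _ _ _ C3 Cq t1.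
have E1 : p + - (2 * t * v.1) *: dir R true + 2^-1 *: (p + - (2 * t * v.2) *: dir R false -
   (p + - (2 * t * v.1) *: dir R true)) = p + - t *: v.
  by pair_eq; field.
have E2 : p + - t *: v + (t / (1 + t)) *: (q - (p + - t *: v)) = p.
  by pair_eq; field; rewrite gt_eqF.
rewrite E1 in K1; rewrite E2 in K2.
have B1 := H1 _ h11; have B2 := H2 _ h22.
rewrite normrN normrM (gtr0_norm (mulr_gt0 _ t0)) // in B1.
rewrite normrN normrM (gtr0_norm (mulr_gt0 _ t0)) // in B2.
move: B1 B2 => /ler_normlP[B1 _] /ler_normlP[B2 _].
set a := u (p + - t *: v) in K1 K2; set a1 := u (p + _) in K1 B1; set a2 := u (p + - (2 * t * v.2) *: _) in K1 B2.
have K2' : (1 + t) * u p >= a + t * u q.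
  have : (1 + t) * (a + t / (1 + t) * (u q - a)) <= (1 + t) * u p by rewrite ler_pM2l //; lra.
  have -> : (1 + t) * (a + t / (1 + t) * (u q - a)) = a + t * u q by field; rewrite gt_eqF.
  by [].
have eMM : e / M * (`|v.1| + `|v.2|) <= e.
  have : e / M * (`|v.1| + `|v.2|) <= e / M * M by rewrite ler_wpM2l ?(ltW eM) // /M; lra.
  by rewrite divfK // gt_eqF.
clearbody a a1 a2 M; clear H1 H2 H3 H4 H5 C1 C2 C3 E1 E2.
have : t * u q <= t * (u p + 'D_(dir R true) u p * v.1 + 'D_(dir R false) u p * v.2 + e).
  have : t * (e / M * (`|v.1| + `|v.2|)) <= t * e by rewrite ler_wpM2l // ltW.
  move: B1 B2; set A1 := e / M * (2 * t * `|v.1|); set A2 := e / M * (2 * t * `|v.2|).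
  have -> : t * (e / M * (`|v.1| + `|v.2|)) = (A1 + A2) / 2 by rewrite /A1 /A2; field; rewrite gt_eqF.
  rewrite !mulrDr; lra.
by rewrite ler_pM2l.
Qed.

Lemma convex_interior_segment A p q t : convex2 A -> A° p -> closure A q -> 0 <= t < 1 ->
  A° (p + t *: (q - p)).
Proof.
move=> cA /interior_boxP[e e0 eA] /closure_boxP cq /andP[t0 t1].
(* Solving [w = p' + t *: (q' - p')] for [p'] divides errors below [n] and [t * n] by [1 - t], so
   [p'] is within [e] of [p]. *)
pose n := e * (1 - t) / 2; have n0 : 0 < n by rewrite divr_gt0 // mulr_gt0 // subr_gt0.
have [q' Aq' [h1 h2]] := cq _ n0.
apply/interior_boxP; exists n => // w w1 w2.
have s0 : 1 - t != 0 by rewrite gt_eqF // subr_gt0.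
pose p' : R * R := ((w.1 - t * q'.1) / (1 - t), (w.2 - t * q'.2) / (1 - t)).
have -> : w = p' + t *: (q' - p').
  by rewrite /p' {1}(surjective_pairing w); pair_eq; field.
apply: cA => //; last by rewrite t0 ltW.
have b x y (a c : R) : `|x - (a + t * (c - a))| < n -> `|y - c| < n ->
    `|(x - t * y) / (1 - t) - a| < e.
  move=> /ltr_normlP[B1 B2] /ltr_normlP[B3 B4].
  have -> : (x - t * y) / (1 - t) - a = (x - (a + t * (c - a)) - t * (y - c)) / (1 - t) by field.
  rewrite normrM normfV (gtr0_norm (_ : 0 < 1 - t)) ?subr_gt0 // ltr_pdivrMr ?subr_gt0 //.
  have -> : e * (1 - t) = n + n by rewrite /n; field.
  by rewrite ltr_norml; apply/andP; split; nra.
by apply: eA; [apply: b w1 h1|apply: b w2 h2].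
Qed.

End plane.

(** * Extension by zero of admissible functions *)

Section extension.
Variable R : realType.
Implicit Types (p q : R * R).

Lemma convex_set_convex2 (A : set (R * R)) : convex_set A -> convex2 A.
Proof.
move=> cA p q t Ap Aq /andP[t0 t1].
have := cA q p (Itv01 t0 t1) (mem_set Aq) (mem_set Ap) => /set_mem; congr A.
by pair_eq; rewrite /unstable.onem; ring.
Qed.

Lemma convex_function_concave2 (C : set (R * R)) (u : R * R -> R) :
  convex_function C (fun p => - u p) -> concave2 C u.
Proof.
move=> cu p q t Cp Cq /andP[t0 t1].
have := cu (Itv01 t0 t1) _ _ (mem_set Cq) (mem_set Cp).
have -> : conv (Itv01 t0 t1) (q : convex_lmodType (R * R)%type) p = p + t *: (q - p).
  by pair_eq; rewrite /unstable.onem; ring.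
rewrite convRE /= /unstable.onem; lra.
Qed.

Lemma concave2_convex_function (C : set (R * R)) (u : R * R -> R) :
  concave2 C u -> convex_function C (fun p => - u p).
Proof.
move=> cu k q p /set_mem Cq /set_mem Cp.
have k01 : 0 <= k%:num <= 1 by apply/andP; split.
have := cu p q k%:num Cp Cq k01.
have -> : conv k q p = (p : R * R) + k%:num *: (q - p).
  by pair_eq; rewrite /unstable.onem; ring.
rewrite convRE /= /unstable.onem; lra.
Qed.

Lemma bounded_set_box (A : set (R * R)) : bounded_set A ->
  exists2 M : R, 0 < M & forall p, closure A p -> `|p.1| <= M /\ `|p.2| <= M.
Proof.
case=> M [_ hM].
have hA p : A p -> `|p.1| <= `|M| + 1 /\ `|p.2| <= `|M| + 1.
  have lt : M < `|M| + 1 by have := ler_norm M; lra.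
  by move=> /(hM _ lt); rewrite /= prod_normE ge_max => /andP[].
exists (`|M| + 2) => [|p /closure_boxP/(_ 1 ltr01)[q Aq [h1 h2]]].
  by rewrite ltr_wpDl.
have [q1 q2] := hA _ Aq.
have t1 := ler_distD q.1 p.1 0; have t2 := ler_distD q.2 p.2 0.
rewrite !subr0 distrC in t1; rewrite !subr0 distrC in t2.
by split; lra.
Qed.

Section admissible.
Variables (Omega : set (R * R)) (u : R * R -> R).
Hypotheses (bO : bounded_set Omega) (cO : convex_set Omega) (au : admissible Omega u).
Let Om : set (R * R) := Omega°.
Let C : set (R * R) := closure Omega.

(** Admissibility constrains [u] only on the closure. The extension is continuous on the whole plane
    and vanishes off the interior, which is what slicing and measurability ask for; it stays concave
    on the closure. *)
Definition zero_ext p : R := if p \in (Omega° : set (R * R)) then u p else 0.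
Let U := zero_ext.

Lemma zero_ext_in p : Om p -> U p = u p.
Proof. by move=> Op; rewrite /U /zero_ext mem_set. Qed.

Lemma zero_ext_out p : ~ Om p -> U p = 0.
Proof. by move=> Op; rewrite /U /zero_ext memNset. Qed.

Lemma zero_ext_closure p : C p -> U p = u p.
Proof.
move=> Cp; have [Op|nO] := pselect (Om p); first exact: zero_ext_in.
by rewrite zero_ext_out //; case: au => _ _ b0 _; rewrite b0.
Qed.

Lemma interior_subset_closure : Om `<=` C.
Proof. by move=> p /interior_subset; exact: subset_closure. Qed.

Lemma zero_ext_concave : concave2 C U.
Proof.
case: au => _ /convex_function_concave2 cu b0 _ p q t Cp Cq ht.
have [e|t1] := eqVneq t 1; first by rewrite e scale1r [p + _]addrC subrK; lra.
have := cu p q t Cp Cq ht; rewrite (zero_ext_closure Cp) (zero_ext_closure Cq).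
suff Cz : C (p + t *: (q - p)) by rewrite (zero_ext_closure Cz).
apply/closure_boxP => e e0; move/closure_boxP : Cp => /(_ _ e0)[p' Ap [p1 p2]].
move/closure_boxP : Cq => /(_ _ e0)[q' Aq [q1 q2]].
exists (p' + t *: (q' - p')); first exact: convex_set_convex2.
have b (a c a' c' : R) : `|a' - a| < e -> `|c' - c| < e ->
    `|a' + t * (c' - a') - (a + t * (c - a))| < e.
  case/andP: ht => t0 t01; have {}t1 : t < 1 by rewrite lt_neqAle t1.
  move=> /ltr_normlP[? ?] /ltr_normlP[? ?].
  by rewrite ltr_norml; apply/andP; split; nra.
by split; [exact: b p1 q1|exact: b p2 q2].
Qed.

Lemma zero_ext_continuous : continuous U.
Proof.
case: au => ctu _ b0 _ p; have oOm : open Om by exact: open_interior.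
have [Op|nO] := pselect (Om p).
  have nO : \forall q \near p, u q = U q.
    by apply: (filterS _ (open_nbhs_nbhs (conj oOm Op))) => q Oq; rewrite zero_ext_in.
  rewrite /continuous_at (zero_ext_in Op); apply: (cvg_trans (near_eq_cvg nO)).
  have : {within Om, continuous u} by apply: continuous_subspaceW ctu; exact: interior_subset_closure.
  by rewrite continuous_open_subspace // => /(_ p (mem_set Op)).
rewrite /continuous_at (zero_ext_out nO); apply/cvgrPdist_lt => e e0.
have [Cp|nC] := pselect (C p); last first.
  have oC : open (~` C) by apply: closed_openC; exact: closed_closure.
  apply: (filterS _ (open_nbhs_nbhs (conj oC nC))) => q nCq.
  by rewrite zero_ext_out ?subrr ?normr0 // => /interior_subset_closure.
have up0 : u p = 0 by apply: b0.
have : u x @[x --> within C (nbhs p)] --> (0 : R).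
  by rewrite -up0; exact: (subspace_continuousP _ _).1 ctu p Cp.
move/cvgrPdist_lt => /(_ _ e0); rewrite near_withinE; apply: filterS => q.
have [Oq|nOq] := pselect (Om q); last by rewrite zero_ext_out // subrr normr0.
by rewrite zero_ext_in //; apply; exact: interior_subset_closure.
Qed.

Lemma zero_ext_derive p v : Om p -> 'D_v u p = 'D_v U p.
Proof.
move=> Op; apply: near_eq_derive.
have oOm : open Om by exact: open_interior.
by apply: (filterS _ (open_nbhs_nbhs (conj oOm Op))) => q Oq; rewrite zero_ext_in.
Qed.

Lemma energy_x_ext : energy_x Omega u =
  (\int[@lebesgue2 R]_(p in Om) (('D_(dir R true) U p) ^+ 2)%:E)%E.
Proof. by apply: eq_integral => p /set_mem Op; rewrite /partial_x (zero_ext_derive _ Op). Qed.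

Lemma energy_y_ext : energy_y Omega u =
  (\int[@lebesgue2 R]_(p in Om) (('D_(dir R false) U p) ^+ 2)%:E)%E.
Proof. by apply: eq_integral => p /set_mem Op; rewrite /partial_y (zero_ext_derive _ Op). Qed.

Lemma exit_closure p q : Om p -> ~ Om q ->
  exists2 r : R, 0 < r <= 1 & C (p + r *: (q - p)) /\ ~ Om (p + r *: (q - p)).
Proof.
move=> Op nOq; have oOm : open Om by exact: open_interior.
have [r [/andP[r0 r1] nO inO]] := first_exit oOm Op nOq; exists r; first by rewrite r0.
split => //; apply/closure_boxP => e e0.
pose M := `|(q - p).1| + `|(q - p).2| + 1.
have M0 : 0 < M by rewrite ltr_wpDl // addr_ge0.
pose h := Num.min r (e / (2 * M)).
have h0 : 0 < h by rewrite lt_min r0 divr_gt0 // mulr_gt0.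
have hr : h <= r by rewrite ge_min lexx.
have hM : h * M < e.
  have : h <= e / (2 * M) by rewrite ge_min lexx orbT.
  rewrite -(ler_pM2r M0); have -> : e / (2 * M) * M = e / 2 by field; rewrite gt_eqF.
  lra.
exists (p + (r - h) *: (q - p)).
  by apply: interior_subset; apply: inO; rewrite subr_ge0 hr /= ltrBlDr ltrDl.
have b (a c : R) : `|c - a| <= M -> `|a + (r - h) * (c - a) - (a + r * (c - a))| < e.
  move=> hc; have -> : a + (r - h) * (c - a) - (a + r * (c - a)) = - (h * (c - a)) by ring.
  rewrite normrN normrM (gtr0_norm h0); apply: le_lt_trans hM.
  by rewrite ler_wpM2l // ltW.
have n1 := normr_ge0 (q - p).1; have n2 := normr_ge0 (q - p).2.
by split; apply: b; rewrite /M /= in n1 n2 *; lra.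
Qed.

(** The horizontal line through [p] leaves the interior on both sides at points of the closure where
    [U] vanishes, and [U] is concave between them. *)
Lemma zero_ext_ge0 p : 0 <= U p.
Proof.
have [Op|nO] := pselect (Om p); last by rewrite zero_ext_out.
have [M M0 hM] := bounded_set_box bO.
have out (c : R) : M < `|c| -> ~ Om (c, p.2).
  by move=> h /interior_subset_closure/hM[/= + _]; rewrite leNgt h.
have M1 : `|M + 1| = M + 1 by rewrite gtr0_norm //; lra.
have [r /andP[r0 r1] [Ca nOa]] := exit_closure Op (out (M + 1) ltac:(rewrite M1; lra)).
have [r' /andP[r'0 r'1] [Cb nOb]] := exit_closure Op (out (- (M + 1)) ltac:(rewrite normrN M1; lra)).
have [hp _] := hM _ (interior_subset_closure Op); move/ler_normlP : hp => [p1 p2].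
set a := p + _ in Ca nOa; set b := p + _ in Cb nOb.
pose A := r * (M + 1 - p.1); pose B := r' * (M + 1 + p.1).
have A0 : 0 < A by apply: mulr_gt0 => //; lra.
have B0 : 0 < B by apply: mulr_gt0 => //; lra.
have AB : 0 < A + B by exact: addr_gt0.
have ht : 0 <= A / (A + B) <= 1.
  by rewrite divr_ge0 ?(ltW A0) ?(ltW AB) //= ler_pdivrMr // mul1r lerDl ltW.
have := zero_ext_concave Ca Cb ht; rewrite -/U (zero_ext_out nOa) (zero_ext_out nOb) subrr mulr0 addr0.
have -> // : a + (A / (A + B)) *: (b - a) = p.
have e0 : A + B != 0 by rewrite gt_eqF.
rewrite /a /b; pair_eq; last by ring.
have -> : p.1 + r * (M + 1 - p.1) = p.1 + A by [].
have -> : p.1 + r' * (- (M + 1) - p.1) = p.1 - B by rewrite /B; ring.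
by field.
Qed.

End admissible.
End extension.

(** * Comparison of the energies between two angular points *)

Ltac nonneg := repeat (first [exact: sqr_ge0 | exact: ler0n | apply: addr_ge0 | apply: mulr_ge0]).

Section energy_comparison.
Variable R : realType.
Implicit Types (p q : R * R).
Local Notation mu := (@lebesgue_measure R).

Section energies.
Variables (Om C : set (R * R)) (U : R * R -> R).
Hypotheses (oOm : open Om) (OC : Om `<=` C) (ctU : continuous U) (cU : concave2 C U)
  (U0 : forall p, ~ Om p -> U p = 0) (Uge0 : forall p, 0 <= U p).

Definition energy b : \bar R := (\int[@lebesgue2 R]_(p in Om) (('D_(dir R b) U p) ^+ 2)%:E)%E.

Let cUO : concave2 Om U.
Proof. by move=> p q t /OC Cp /OC Cq; exact: cU. Qed.

Let mOm : measurable Om.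
Proof. exact: open_measurable2. Qed.

Lemma measurable_energy b : measurable_fun Om (fun p => (('D_(dir R b) U p) ^+ 2)%:E).
Proof. by apply/measurable_EFinP; apply: measurable_funX; exact: measurable_derive. Qed.

Let E0 b p : Om p -> (0 <= (('D_(dir R b) U p) ^+ 2)%:E)%E.
Proof. by rewrite lee_fin sqr_ge0. Qed.

Lemma energy_ge0 b : (0 <= energy b)%E.
Proof. by apply: integral_ge0 => p /E0. Qed.

Lemma measurable_weight (w : R -> R) : measurable_fun setT w ->
  (forall p, Om p -> 0 < w p.1) -> measurable_fun Om (fun p => (U p / w p.1) ^+ 2).
Proof.
move=> mw w0; apply: measurable_funX; apply: measurable_funM.
  by apply: measurable_funTS; exact: continuous_measurable2.
apply: (@eq_measurable_fun _ _ _ _ _ (fun p => powR (w p.1) (-1))).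
  by move=> p /set_mem/w0/ltW; exact: powR_inv1.
apply: measurable_funTS; apply: (measurableT_comp (measurable_powR _)).
by apply: measurableT_comp => //; exact: measurable_fst.
Qed.

(** On a vertical slice [w] is constant and the slice has length at most [2 * K * w]. The slice
    estimate gives [U ^ 2 <= 3 * K * w * e] with [e] the slice energy; dividing by [w ^ 2] and
    integrating over the slice gives [6 * K ^ 2 * e]. *)
Lemma weighted_poincare (K z : R) (w : R -> R) : 0 < K -> measurable_fun setT w ->
  (forall p, Om p -> 0 < w p.1 /\ `|p.2 - z| <= K * w p.1) ->
  (\int[@lebesgue2 R]_(p in Om) ((U p / w p.1) ^+ 2)%:E <= (6 * K ^+ 2)%:E * energy false)%E.
Proof.
move=> K0 mw hw.
have mF : measurable_fun Om (fun p => ((U p / w p.1) ^+ 2)%:E).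
  by apply/measurable_EFinP; apply: measurable_weight => // p /hw[].
have F0 p : Om p -> (0 <= ((U p / w p.1) ^+ 2)%:E)%E by rewrite lee_fin sqr_ge0.
have [mI ->] := integral_slices false mOm mF F0.
have [mE EE] := integral_slices false mOm (measurable_energy false) (@E0 false).
rewrite /energy EE; have S0 s : (0 <= slice_integral Om false (fun p => (('D_(dir R false) U p) ^+ 2)%:E) s)%E.
  by apply: integral_ge0 => t /E0.
have c0 : 0 <= 6 * K ^+ 2 by rewrite mulr_ge0 // sqr_ge0.
rewrite -ge0_integralZl //.
apply: ge0_le_integral => //.
- by move=> s _; apply: integral_ge0 => t /F0.
- by apply: emeasurable_funM => //; exact: measurable_cst.
move=> s _; rewrite /slice_integral.
have mS : measurable [set t | Om (pt false s t)] by exact: measurable_slice.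
have [e|/set0P[t0 Ot0]] := eqVneq [set t | Om (pt false s t)] set0.
  by rewrite e !integral_set0 mule0.
have [/= ws _] := hw _ Ot0.
have low t : Om (pt false s t) -> ((U (pt false s t) ^+ 2 / (3 * K * w s))%:E <=
    slice_integral Om false (fun p => (('D_(dir R false) U p) ^+ 2)%:E) s)%E.
  (* A shift by [3 * K * w s], strictly more than the length of the slice, surely leaves [Om]. *)
  move=> Ot; have Kw : 0 < 3 * K * w s by rewrite !mulr_gt0.
  have nO : ~ Om (pt false s (t + 3 * K * w s)).
    move=> Ot'; have [_ /= /ler_normlP[h1 h2]] := hw _ Ot.
    by have [_ /= /ler_normlP[h3 h4]] := hw _ Ot'; nra.
  have := slice_energy_ge oOm cUO ctU U0 Ot nO (Uge0 _).
  have -> : t - (t + 3 * K * w s) = - (3 * K * w s) by ring.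
  by rewrite normrN gtr0_norm.
move: low; rewrite -[(\int[_]_(t in _) (('D__ U _) ^+ 2)%:E)%E]/(slice_integral Om false (fun p => (('D_(dir R false) U p) ^+ 2)%:E) s).
move: (S0 s); case: (slice_integral _ _ _ _) => [e e0 low|_ _|//]; last first.
  by rewrite gt0_muley ?leey // lte_fin mulr_gt0 // exprn_gt0.
rewrite lee_fin in e0.
apply: (@le_trans _ _ (\int[mu]_(t in [set t | Om (pt false s t)]) (3 * K * e / w s)%:E)%E).
  apply: ge0_le_integral => //.
  - by move=> t /F0.
  - exact: (@measurable_fun_slice R Om false s _ mOm mF).
  move=> t Ot /=; rewrite lee_fin; have := low _ Ot; rewrite lee_fin.
  rewrite ler_pdivrMr ?mulr_gt0 // => h.
  rewrite expr_div_n ler_pdivrMr ?exprn_gt0 //.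
  by have -> : 3 * K * e / w s * w s ^+ 2 = e * (3 * K * w s) by field; rewrite gt_eqF.
rewrite integral_cst // -EFinM.
have sub : [set t | Om (pt false s t)] `<=` `[z - K * w s, z + K * w s]%classic.
  move=> t Ot; have [_ /= /ler_normlP[h1 h2]] := hw _ Ot.
  by rewrite /= in_itv /=; apply/andP; split; lra.
have ml : (mu [set t | Om (pt false s t)] <= (2 * K * w s)%:E)%E.
  apply: (@le_trans _ _ (mu `[z - K * w s, z + K * w s]%classic)).
    by apply: le_measure => //; rewrite inE.
  rewrite lebesgue_measure_itv /= lte_fin; case: ifPn => _; last first.
    by rewrite lee_fin !mulr_ge0 // ltW.
  by rewrite -EFinD lee_fin; lra.
have k0 : 0 <= 3 * K * e / w s by rewrite divr_ge0 ?(ltW ws) // !mulr_ge0 // ltW.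
apply: (@le_trans _ _ ((3 * K * e / w s)%:E * (2 * K * w s)%:E)%E); first by rewrite lee_wpmul2l.
rewrite -EFinM lee_fin.
by have -> : 3 * K * e / w s * (2 * K * w s) = 6 * K ^+ 2 * e by field; rewrite gt_eqF.
Qed.

Lemma ae_derivable b : {ae @lebesgue2 R, forall p, Om p -> derivable U p (dir R b)}.
Proof.
exists (nonderivable Om U b); split.
- exact: measurable_nonderivable.
- exact: nonderivable_null.
- by move=> p /= h; apply: contrapT => nN; apply: h => Op; apply: contrapT => nd; exact: nN.
Qed.

(** From [(A + B + D) ^ 2 <= 3 * (A ^ 2 + B ^ 2 + D ^ 2)] with two Poincare terms and
    [D = K * |u_y|]: the constant is [3 * 6 + 3 * 6 + 3 = 39]. *)
Lemma energy_bound (K : R) (xi eta : R * R) : 0 < K -> C xi -> C eta -> U xi = 0 -> U eta = 0 ->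
  (forall p, Om p -> `|p.2 - xi.2| <= K * (p.1 - xi.1)) ->
  (forall p, Om p -> `|p.2 - eta.2| <= K * (eta.1 - p.1)) ->
  (energy true <= (39 * K ^+ 2)%:E * energy false)%E.
Proof.
move=> K0 Cxi Ceta Uxi Ueta cone1 cone2.
(* Strict because [Om] is open: the cone inequality already gives a nonnegative distance at a point
   slightly to the left of [p]. *)
have pos1 p : Om p -> 0 < p.1 - xi.1.
  move=> Op; have [e e0 eO] := open_segment_near (dir R true) oOm Op.
  have /eO/cone1 : `|- (e / 2)| < e by rewrite normrN gtr0_norm; lra.
  move/(le_trans (normr_ge0 _)) => /=; scale_mul; rewrite pmulr_rge0 //; lra.
have pos2 p : Om p -> 0 < eta.1 - p.1.
  move=> Op; have [e e0 eO] := open_segment_near (dir R true) oOm Op.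
  have /eO/cone2 : `|e / 2| < e by rewrite gtr0_norm; lra.
  move/(le_trans (normr_ge0 _)) => /=; scale_mul; rewrite pmulr_rge0 //; lra.
pose w1 x := x - xi.1; pose w2 x := eta.1 - x.
have mw1 : measurable_fun setT w1 by apply: measurable_funB.
have mw2 : measurable_fun setT w2 by apply: measurable_funB.
have P1 := weighted_poincare K0 mw1 (fun p Op => conj (pos1 p Op) (cone1 p Op)).
have P2 := weighted_poincare K0 mw2 (fun p Op => conj (pos2 p Op) (cone2 p Op)).
have mW1 := measurable_weight mw1 pos1.
have mW2 := measurable_weight mw2 pos2.
have mD : measurable_fun Om (fun p => ('D_(dir R false) U p) ^+ 2).
  by apply: measurable_funX; exact: measurable_derive.
pose G p := (3 * (U p / w1 p.1) ^+ 2 + 3 * (U p / w2 p.1) ^+ 2) +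
  3 * K ^+ 2 * ('D_(dir R false) U p) ^+ 2.
have mc c (f : R * R -> R) : measurable_fun Om f -> measurable_fun Om (fun p => c * f p).
  by move=> mf; apply: measurable_funM => //; exact: measurable_cst.
apply: (@le_trans _ _ (\int[@lebesgue2 R]_(p in Om) (G p)%:E)%E).
  apply: ae_ge0_le_integral => //.
  - by move=> p /E0.
  - exact: (measurable_energy true).
  - by move=> p Op; rewrite lee_fin; nonneg.
  - apply/measurable_EFinP; apply: measurable_funD; last exact: mc.
    by apply: measurable_funD; apply: mc; (exact: mW1 || exact: mW2).
  have FF := ae_filter_ringOfSetsType (@lebesgue2 R : {measure set _ -> \bar R}).
  apply: (@filterS2 _ _ FF _ _ _ _ (ae_derivable true) (ae_derivable false)) => p dx dy Op.
  rewrite lee_fin /G.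
  have S1 := supergradient oOm OC cU Op Cxi (dx Op) (dy Op).
  have S2 := supergradient oOm OC cU Op Ceta (dx Op) (dy Op).
  rewrite Uxi in S1; rewrite Ueta in S2.
  have p1 := pos1 _ Op; have p2 := pos2 _ Op; have c1 := cone1 _ Op; have c2 := cone2 _ Op.
  move: S1 S2; set ux := 'D_(dir R true) U p; set uy := 'D_(dir R false) U p => S1 S2.
  have T1 : ux <= U p / w1 p.1 + K * `|uy|.
    rewrite -(ler_pM2r p1) mulrDl divfK ?gt_eqF //.
    have : uy * (xi.2 - p.2) <= `|uy| * (K * (p.1 - xi.1)).
      by apply: le_trans (ler_norm _) _; rewrite normrM distrC ler_wpM2l.
    by rewrite /w1; lra.
  have T2 : - ux <= U p / w2 p.1 + K * `|uy|.
    rewrite -(ler_pM2r p2) mulrDl divfK ?gt_eqF //.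
    have : uy * (eta.2 - p.2) <= `|uy| * (K * (eta.1 - p.1)).
      by apply: le_trans (ler_norm _) _; rewrite normrM distrC ler_wpM2l.
    by rewrite /w2; lra.
  have A0 : 0 <= U p / w1 p.1 by rewrite divr_ge0 // ltW.
  have B0 : 0 <= U p / w2 p.1 by rewrite divr_ge0 // ltW.
  have <- : `|uy| ^+ 2 = uy ^+ 2 by rewrite real_normK // num_real.
  move: A0 B0 T1 T2; move: (U p / w1 p.1) (U p / w2 p.1) (normr_ge0 uy) => A B.
  move: (`|uy|) => y y0 A0 B0 T1 T2; have Ky : 0 <= K * y by rewrite mulr_ge0 // ltW.
  have : ux ^+ 2 <= (A + B + K * y) ^+ 2.
    rewrite -ler_sqrt ?sqr_ge0 // !sqrtr_sqr ler_norml ger0_norm ?addr_ge0 //.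
    by apply/andP; split; lra.
  move/le_trans; apply; rewrite -mulrA -exprMn.
  move: (K * y) Ky => D D0.
  have := sqr_ge0 (A - B); have := sqr_ge0 (A - D); have := sqr_ge0 (B - D); nra.
have ge (c : R) (f : R * R -> R) : 0 <= c -> forall p, Om p -> (0 <= (c * f p ^+ 2)%:E)%E.
  by move=> c0 p _; rewrite lee_fin mulr_ge0 // sqr_ge0.
have K2 : 0 <= 3 * K ^+ 2 by rewrite mulr_ge0 // sqr_ge0.
have i3 c (f : R * R -> R) : 0 <= c -> measurable_fun Om (fun p => f p ^+ 2) ->
    (\int[@lebesgue2 R]_(p in Om) (c * f p ^+ 2)%:E = c%:E * \int[@lebesgue2 R]_(p in Om) (f p ^+ 2)%:E)%E.
  move=> c0 mf; under eq_integral do rewrite EFinM.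
  rewrite ge0_integralZl //; first by apply/measurable_EFinP.
  by move=> p _; rewrite lee_fin sqr_ge0.
rewrite /G; under eq_integral do rewrite EFinD.
rewrite ge0_integralD //; first last.
- by apply/measurable_EFinP; exact: mc.
- by apply: ge.
- by apply/measurable_EFinP; apply: measurable_funD; apply: mc; (exact: mW1 || exact: mW2).
- by move=> p Op; rewrite lee_fin; nonneg.
under [X in (X + _ <= _)%E]eq_integral do rewrite EFinD.
rewrite ge0_integralD //; first last.
- by apply/measurable_EFinP; apply: mc; (exact: mW1 || exact: mW2).
- by apply: ge.
- by apply/measurable_EFinP; apply: mc; (exact: mW1 || exact: mW2).
- by apply: ge.
rewrite !i3 //; try (exact: mW1 || exact: mW2).
rewrite -/(energy false); have Eg := energy_ge0 false.
apply: (@le_trans _ _ (3%:E * ((6 * K ^+ 2)%:E * energy false) +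
   3%:E * ((6 * K ^+ 2)%:E * energy false) + (3 * K ^+ 2)%:E * energy false)%E).
  by rewrite leeD2r // leeD // lee_wpmul2l.
have K60 : 0 <= 6 * K ^+ 2 by rewrite mulr_ge0 // sqr_ge0.
rewrite !muleA -!EFinM -!ge0_muleDl ?lee_fin ?addr_ge0 ?mulr_ge0 ?sqr_ge0 ?(ltW K0) //.
rewrite -!EFinD; have -> // : 3 * (6 * K ^+ 2) + 3 * (6 * K ^+ 2) + 3 * K ^+ 2 = 39 * K ^+ 2 by ring.
Qed.

End energies.

(** Degenerate quotients: [y = 0] forces [x = 0], and [0] times the inverse of [0] is [0]; the
    inverse of [+oo] is [0]. *)
Lemma div_le_of_le_mul (c : R) (x y : \bar R) : 0 <= c -> (0 <= x)%E -> (0 <= y)%E ->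
  (x <= c%:E * y)%E -> (x / y <= c%:E)%E.
Proof.
move=> c0 x0; case: y => [r r0 h|_ _|//]; last by rewrite /inve mule0 lee_fin.
rewrite lee_fin in r0; have [e|rn] := eqVneq r 0.
  move: h; rewrite e mule0 => h; have -> : x = 0%E by apply/eqP; rewrite eq_le h x0.
  by rewrite mul0e lee_fin.
have r1 : 0 < r by rewrite lt_neqAle eq_sym rn.
by rewrite inver (negbTE rn) lee_pdivrMr.
Qed.

End energy_comparison.

(** * Vertical lines of support *)

Section support.
Variable R : realType.
Variable Omega : set (R * R).
Implicit Types (p q xi : R * R).

(** The sign [(-1) ^+ sg] treats both vertical lines at once: [false] puts the set to the right of
    the line, [true] to the left. *)
Lemma closure_halfplane (c : R) (sg : bool) :
  (forall p, Omega p -> 0 <= (-1) ^+ sg * (p.1 - c)) ->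
  forall p, closure Omega p -> 0 <= (-1) ^+ sg * (p.1 - c).
Proof.
move=> h p /closure_boxP cp; rewrite leNgt; apply/negP => n.
have [q Aq [h1 _]] := cp (- ((-1) ^+ sg * (p.1 - c))) ltac:(by rewrite oppr_gt0).
by move: (h _ Aq) n h1 => + + /ltr_normlP[]; case: (sg); rewrite ?expr1 ?expr0 ?mul1r ?mulN1r; lra.
Qed.

Lemma support_vertical_side c : support_line Omega (vertical_line c) ->
  exists2 sg : bool, (forall p, closure Omega p -> 0 <= (-1) ^+ sg * (p.1 - c)) &
    exists2 xi, closure Omega xi & xi.1 = c.
Proof.
move=> [a [b [c' [ab E le [xi [lxi Cxi]]]]]].
have on y : a * c + b * y = c'.
  by have : line a b c' (c, y) by rewrite -E.
have b0 : b = 0 by have := on 0; have := on 1; lra.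
have a0 : a != 0 by apply: contraNneq ab => ->; rewrite b0.
have hc := on 0; rewrite mulr0 addr0 in hc.
exists (0 < a); last by exists xi.
apply: closure_halfplane => p /le; rewrite b0 mul0r addr0 -hc.
have [a1|a1|a1] := ltrgtP 0 a; last by rewrite -a1 eqxx in a0.
  by rewrite ler_pM2l // expr1 mulN1r; lra.
by rewrite ler_nM2l // expr0 mul1r; lra.
Qed.

Lemma vertical_side_support xi (sg : bool) : closure Omega xi ->
  (forall p, closure Omega p -> 0 <= (-1) ^+ sg * (p.1 - xi.1)) ->
  support_line Omega (vertical_line xi.1).
Proof.
move=> Cxi h; exists (- (-1) ^+ sg), 0, (- (-1) ^+ sg * xi.1); split.
- by rewrite xpair_eqE oppr_eq0 signr_eq0.
- apply/seteqP; split => p; rewrite /line /vertical_line /= mul0r addr0; first by move=> ->.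
  by apply: mulfI; rewrite oppr_eq0 signr_eq0.
- by move=> p Op; have := h _ (subset_closure Op); rewrite mul0r addr0; lra.
- by exists xi; split.
Qed.

Lemma not_interior_side xi (sg : bool) :
  (forall p, closure Omega p -> 0 <= (-1) ^+ sg * (p.1 - xi.1)) -> ~ Omega° xi.
Proof.
move=> h /interior_boxP[e e0 eO].
have : Omega (xi.1 - (-1) ^+ sg * (e / 2), xi.2).
  apply: eO => /=; last by rewrite subrr normr0.
  rewrite addrC addKr normrN normrM normr_sign mul1r gtr0_norm; lra.
move/subset_closure/h => /=.
by case: (sg); rewrite ?expr1 ?expr0 ?mul1r ?mulN1r; lra.
Qed.

(** The points of the line at height 1 above and below the vertex are off the closed tangent cone,
    hence at a horizontal distance at least [e] from the points of the cone at those heights.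
    Scaling a point of [Omega] about the vertex to height 1 or -1 gives the slope bound [e^-1]. *)
Lemma angular_cone c : angular Omega (vertical_line c) ->
  exists2 xi, boundary Omega xi /\ xi.1 = c &
    exists2 K : R, 0 < K & forall p, Omega p -> `|p.2 - xi.2| <= K * `|p.1 - c|.
Proof.
move=> [_ [xi [bxi _] E]]; exists xi.
  by split => //; have [//] : (vertical_line c `&` tangent_cone Omega xi) xi by rewrite E.
have xc : xi.1 = c by have [] : (vertical_line c `&` tangent_cone Omega xi) xi by rewrite E.
have out (s : R) : s != 0 -> exists2 e : R, 0 < e & forall p t, Omega p -> 0 <= t ->
    `|t * (p.1 - c)| < e -> xi.2 + t * (p.2 - xi.2) = xi.2 + s -> False.
  move=> s0; apply: contrapT => H.
  have : (vertical_line c `&` tangent_cone Omega xi) (c, xi.2 + s).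
    split => //; apply/closure_boxP => e e0; apply: contrapT => H2; apply: H; exists e => // p t Op t0 h1 h2.
    apply: H2; exists (xi + t *: (p - xi)); first by exists p, t.
    split => /=; scale_mul; last by rewrite h2 subrr normr0.
    by rewrite xc addrC addKr.
  rewrite E => /(congr1 snd) /=; move/eqP; rewrite -subr_eq0 addrC addKr; exact/negP.
have [e1 e10 H1] := out 1 (oner_neq0 _).
have [e2 e20 H2] := out (-1) ltac:(by rewrite oppr_eq0 oner_neq0).
pose e := Num.min e1 e2; have e0 : 0 < e by rewrite lt_min e10 e20.
exists e^-1; first by rewrite invr_gt0.
move=> p Op; rewrite leNgt; apply/negP => lt.
have y0 : 0 < `|p.2 - xi.2| by apply: le_lt_trans lt; rewrite mulr_ge0 // invr_ge0 ltW.
pose t := `|p.2 - xi.2|^-1; have t0 : 0 < t by rewrite invr_gt0.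
have te : `|t * (p.1 - c)| < e.
  rewrite normrM (gtr0_norm t0) mulrC ltr_pdivrMr // mulrC -ltr_pdivrMr //.
  by rewrite mulrC.
have [te1 te2] : `|t * (p.1 - c)| < e1 /\ `|t * (p.1 - c)| < e2.
  by move: te; rewrite lt_min => /andP[].
have yn : p.2 - xi.2 != 0 by rewrite -normr_gt0.
have [ps|ng|z] := ltrgtP 0 (p.2 - xi.2); last by rewrite -z eqxx in yn.
  by apply: (H1 p t Op (ltW t0) te1); rewrite /t gtr0_norm // mulVf.
by apply: (H2 p t Op (ltW t0) te2); rewrite /t ltr0_norm // invrN mulNr mulVf.
Qed.

(** If [Omega] lay in the cone of slope [K] at [xi], a slanted line would support it there besides
    the vertical one, making [xi] singular; the tangent cone would lie in the same cone and meet the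
    vertical line only at [xi]. The line would be angular. *)
Lemma not_angular_steep c xi (sg : bool) : Omega !=set0 ->
  support_line Omega (vertical_line c) -> ~ angular Omega (vertical_line c) ->
  (forall p, closure Omega p -> 0 <= (-1) ^+ sg * (p.1 - c)) ->
  closure Omega xi -> xi.1 = c ->
  forall K : R, 0 < K -> exists2 p, Omega p & K * `|p.1 - c| < `|p.2 - xi.2|.
Proof.
move=> [p0 Op0] sl nang side Cxi xc K K0; apply: contrapT => H; apply: nang; split => //.
have cone p : Omega p -> `|p.2 - xi.2| <= K * `|p.1 - c|.
  by move=> Op; rewrite leNgt; apply/negP => lt; apply: H; exists p.
have absE p : closure Omega p -> `|p.1 - c| = (-1) ^+ sg * (p.1 - c).
  by move=> Cp; rewrite -(ger0_norm (side _ Cp)) normrM normr_sign mul1r.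
exists xi.
  have bd : boundary Omega xi.
    by split => //; apply: (@not_interior_side xi sg); rewrite xc.
  split => // -[_ [l [[sll lxi] uni]]].
  have e1 : l = vertical_line c by apply: uni; split.
  (* The upper side of the cone, [y - xi.2 = K * |x - c|] on the side of [Omega]. *)
  pose a := - (-1) ^+ sg * K.
  have e2 : l = line a 1 (a * c + xi.2).
    apply: uni; split; last by rewrite /line /= xc mul1r.
    exists a, 1, (a * c + xi.2); split => //.
    - by rewrite xpair_eqE oner_eq0 andbF.
    - move=> p Op; have := cone _ Op; rewrite (absE _ (subset_closure Op)).
      by move/ler_normlP => [_]; rewrite /a; lra.
    - by exists xi; split => //; rewrite /line /= xc mul1r.
  have : line a 1 (a * c + xi.2) (c, xi.2 + 1) by rewrite -e2 e1.
  by rewrite /line /=; lra.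
apply/seteqP; split => q; last first.
  move=> ->; split => //; apply: subset_closure; exists p0, 0; split => //.
  by rewrite scale0r addr0.
move=> [qc /closure_boxP cq]; apply: pair_ext; first by rewrite qc xc.
apply/eqP; rewrite -subr_eq0 -normr_le0; apply/ler_addgt0Pr => e e0.
have K1 : 0 < 1 + K by rewrite addr_gt0.
(* An error [e / (1 + K)] in each coordinate costs [K * (e / (1 + K)) + e / (1 + K) = e] in
   height. *)
have [_ [p [t [Op t0 ->]]] /= []] := cq (e / (1 + K)) (divr_gt0 e0 K1).
scale_mul; rewrite add0r -(qc : q.1 = c) in xc *.
rewrite xc addrC addKr => h1 h2.
have h3 : `|t * (p.2 - xi.2)| <= K * `|t * (p.1 - q.1)|.
  rewrite !normrM (ger0_norm t0) mulrCA ler_wpM2l //.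
  by rewrite (qc : q.1 = c) cone.
have -> : q.2 - xi.2 = t * (p.2 - xi.2) - (xi.2 + t * (p.2 - xi.2) - q.2) by ring.
apply: (le_trans (ler_normB _ _)).
have h4 : K * `|t * (p.1 - q.1)| <= K * (e / (1 + K)) by rewrite ler_wpM2l // ltW.
have : K * (e / (1 + K)) + e / (1 + K) = e by field; rewrite gt_eqF.
lra.
Qed.

Lemma horizontal_extreme (sg : bool) : bounded_set Omega -> Omega !=set0 ->
  exists2 xi, closure Omega xi & forall p, closure Omega p -> 0 <= (-1) ^+ sg * (p.1 - xi.1).
Proof.
move=> bO [p0 Op0]; have [M M0 hM] := bounded_set_box bO.
have cC : compact (closure Omega).
  apply: (@subclosed_compact _ _ (`[- M, M]%classic `*` `[- M, M]%classic)).
  - exact: closed_closure.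
  - by apply: compact_setX; exact: segment_compact.
  - by move=> p /hM[]; rewrite !ler_norml => h1 h2; split; rewrite /= in_itv.
have ct : {within closure Omega, continuous (fun p : R * R => (-1) ^+ sg * p.1)}.
  apply: continuous_subspaceT => p; apply: cvgM; first exact: cvg_cst.
  exact: cvg_fst.
have [|xi /set_mem Cxi h] := compact_EVT_min _ cC ct.
  by exists p0; exact: subset_closure.
exists xi => // p Cp; have := h p (mem_set Cp); lra.
Qed.

End support.

(** * Cones over a convex set *)

Section gauge.
Variables (R : realType) (Om : set (R * R)) (a : R * R).
Implicit Types (p q w : R * R).

(** Its infimum is the Minkowski functional of [Om - a]. *)
Definition gauge_set w : set R := [set t | 0 < t /\ Om (a + t^-1 *: w)].
Definition gauge w : R := inf (gauge_set w).
Definition cone_fun p : R := 1 - gauge (p - a).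

Definition norm1 w : R := `|w.1| + `|w.2|.

Hypotheses (cOm : convex2 Om) (aO : Om a).
Variable r : R.
Hypotheses (r0 : 0 < r)
  (rO : forall q, `|q.1 - a.1| < r -> `|q.2 - a.2| < r -> Om q).

Lemma norm1_ge0 w : 0 <= norm1 w.
Proof. exact: addr_ge0. Qed.

Lemma gauge_lbound w : lbound (gauge_set w) 0.
Proof. by move=> t [/ltW]. Qed.

Lemma gauge_set_large w t : norm1 w / r < t -> gauge_set w t.
Proof.
move=> h; have t0 : 0 < t by apply: le_lt_trans h; rewrite divr_ge0 ?norm1_ge0 // ltW.
split => //; rewrite ltr_pdivrMr // in h.
have b x : `|x| <= norm1 w -> `|t^-1 * x| < r.
  move=> hx; rewrite normrM normfV (gtr0_norm t0) ltr_pdivrMl //.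
  exact: le_lt_trans h.
by apply: rO => /=; scale_mul; rewrite addrC addKr; apply: b; rewrite /norm1 ?lerDl ?lerDr.
Qed.

Lemma gauge_has_inf w : has_inf (gauge_set w).
Proof.
split; last by exists 0; exact: gauge_lbound.
by exists (norm1 w / r + 1); apply: gauge_set_large; rewrite ltrDl.
Qed.

Lemma gauge_le w t : gauge_set w t -> gauge w <= t.
Proof. by apply: ge_inf; exists 0; exact: gauge_lbound. Qed.

Lemma gauge_ge0 w : 0 <= gauge w.
Proof. by apply: lb_le_inf; [case: (gauge_has_inf w)|exact: gauge_lbound]. Qed.

Lemma gauge_le_norm1 w : gauge w <= norm1 w / r.
Proof.
apply/ler_addgt0Pr => e e0; apply: gauge_le; apply: gauge_set_large.
by rewrite ltrDl.
Qed.

Lemma gauge0 : gauge 0 = 0.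
Proof.
apply/eqP; rewrite eq_le gauge_ge0 andbT (le_trans (gauge_le_norm1 0)) //.
by rewrite /norm1 normr0 addr0 mul0r.
Qed.

Lemma gaugeD w w' : gauge (w + w') <= gauge w + gauge w'.
Proof.
apply/ler_addgt0Pr => e e0; have e2 : 0 < e / 2 by rewrite divr_gt0.
have [t [t0 tO] te] := inf_adherent e2 (gauge_has_inf w).
have [t' [t'0 t'O] t'e] := inf_adherent e2 (gauge_has_inf w').
have tt : 0 < t + t' by exact: addr_gt0.
have : gauge (w + w') <= t + t'.
  apply: gauge_le; split => //.
  (* The point [a + (w + w') / (t + t')] is the convex combination of [a + w / t] and [a + w' / t']
     with weights proportional to [t] and [t']. *)
  have ht : 0 <= t' / (t + t') <= 1.
    by rewrite divr_ge0 ?(ltW t'0) ?(ltW tt) //= ler_pdivrMr // mul1r lerDr ltW.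
  have := cOm tO t'O ht; congr Om.
  by pair_eq; field; rewrite !gt_eqF.
rewrite /gauge in te t'e *; lra.
Qed.

Lemma gaugeZ s w : 0 <= s -> gauge (s *: w) <= s * gauge w.
Proof.
rewrite le_eqVlt => /predU1P[<-|s0]; first by rewrite scale0r gauge0 mul0r.
apply/ler_addgt0Pr => e e0; have es : 0 < e / s by rewrite divr_gt0.
have [t [t0 tO] te] := inf_adherent es (gauge_has_inf w).
have : gauge (s *: w) <= s * t.
  apply: gauge_le; split; first exact: mulr_gt0.
  by move: tO; congr Om; pair_eq; field; rewrite !gt_eqF.
move/le_trans; apply; rewrite -(ler_pM2l (_ : 0 < s^-1)) ?invr_gt0 //.
have -> : s^-1 * (s * t) = t by field; rewrite gt_eqF.
have -> : s^-1 * (s * gauge w + e) = gauge w + e / s by field; rewrite gt_eqF.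
exact: ltW.
Qed.

Lemma cone_fun_apex : cone_fun a = 1.
Proof. by rewrite /cone_fun subrr gauge0 subr0. Qed.

Lemma cone_fun_concave : concave2 setT cone_fun.
Proof.
move=> p q t _ _ /andP[t0 t1]; rewrite /cone_fun.
have -> : p + t *: (q - p) - a = (1 - t) *: (p - a) + t *: (q - a) by pair_eq; ring.
have := gaugeD ((1 - t) *: (p - a)) (t *: (q - a)).
have s0 : 0 <= 1 - t by rewrite subr_ge0.
have := gaugeZ (p - a) s0; have := gaugeZ (q - a) t0; lra.
Qed.

(** By homogeneity of the gauge; it controls the tangent planes at the apex from above. *)
Lemma cone_fun_ray q t : 0 <= t -> cone_fun q - t * (1 - cone_fun q) <= cone_fun (q + t *: (q - a)).
Proof.
move=> t0; rewrite /cone_fun.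
have -> : q + t *: (q - a) - a = (1 + t) *: (q - a) by pair_eq; ring.
have t1 : 0 <= 1 + t by rewrite addr_ge0.
have := gaugeZ (q - a) t1; lra.
Qed.

Lemma cone_fun_lipschitz p q : `|cone_fun p - cone_fun q| <= norm1 (p - q) / r.
Proof.
have E p' q' : cone_fun p' - cone_fun q' <= norm1 (p' - q') / r.
  have h1 := gaugeD (q' - p') (p' - a); have h2 := gauge_le_norm1 (q' - p').
  have e1 : q' - p' + (p' - a) = q' - a by pair_eq; ring.
  have e2 : norm1 (q' - p') = norm1 (p' - q').
    by rewrite /norm1 /= distrC [X in _ + X = _]distrC.
  rewrite /cone_fun; rewrite e1 in h1; rewrite e2 in h2; lra.
rewrite ler_norml E andbT; have := E q p.
have -> : norm1 (q - p) = norm1 (p - q) by rewrite /norm1 /= distrC [X in _ + X = _]distrC.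
lra.
Qed.

(** A parameter [t < 1] in the gauge set would place [p] between [a] and a point of [Om]. *)
Lemma cone_fun_out p : ~ Om p -> cone_fun p <= 0.
Proof.
move=> nO; rewrite /cone_fun subr_le0; apply: lb_le_inf; first by case: (gauge_has_inf (p - a)).
move=> t [t0 tO]; rewrite leNgt; apply/negP => t1; apply: nO.
have := cOm aO tO (_ : 0 <= t <= 1); rewrite !ltW // => /(_ isT).
by congr Om; pair_eq; field; rewrite gt_eqF.
Qed.

Lemma cone_fun_continuous : continuous cone_fun.
Proof.
move=> p; apply/cvgrPdist_lt => e e0.
have er : 0 < e * r / 2 by rewrite divr_gt0 // mulr_gt0.
suff : nbhs p [set q | `|cone_fun p - cone_fun q| < e] by [].
apply/nbhs_ballP; exists (e * r / 2) => // q [h1 h2]; rewrite /ball /= in h1 h2.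
apply: (le_lt_trans (cone_fun_lipschitz p q)); rewrite ltr_pdivrMr // /norm1 /=.
lra.
Qed.

Lemma cone_fun_derive_bound p v : derivable cone_fun p v -> `|'D_v cone_fun p| <= norm1 v / r.
Proof.
move=> d; apply/ler_addgt0Pr => e e0.
have [h0 hh0 H] := derivable_approx d e0.
pose h := h0 / 2; have hp : 0 < h by rewrite divr_gt0.
have := H h; rewrite (gtr0_norm hp) => /(_ ltac:(rewrite /h; lra)) H1.
have := cone_fun_lipschitz (p + h *: v) p.
have -> : norm1 (p + h *: v - p) / r = h * (norm1 v / r).
  have hn (x : R) : `|h * x| = h * `|x| by rewrite normrM (gtr0_norm hp).
  have -> : p + h *: v - p = (h * v.1, h * v.2) by pair_eq; ring.
  by rewrite /norm1 /= !hn; ring.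
move=> H2; rewrite -(ler_pM2l hp) -{1}(gtr0_norm hp) -normrM mulrDr.
move: H1 H2; set x := h * 'D_v _ _; set y := cone_fun (p + h *: v) - cone_fun p.
move=> /ler_normlP[H1 H2] /ler_normlP[H3 H4].
by rewrite ler_norml; apply/andP; split; lra.
Qed.

End gauge.

(** * Admissibility of the cones *)

Section cone_admissible.
Variables (R : realType) (Omega : set (R * R)) (a : R * R).
Hypotheses (cO : convex2 Omega) (aO : Omega° a).

Lemma interior_convex2 : convex2 (Omega° : set (R * R)).
Proof.
move=> p q t Op Oq /andP[t0 t1]; have [e|n1] := eqVneq t 1.
  by rewrite e scale1r [p + _]addrC subrK.
apply: convex_interior_segment => //; last by rewrite t0 lt_neqAle n1.
by apply: subset_closure; exact: interior_subset.
Qed.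

Lemma interior_box : exists2 r : R, 0 < r &
  forall q, `|q.1 - a.1| < r -> `|q.2 - a.2| < r -> (Omega° : set (R * R)) q.
Proof.
apply/interior_boxP.
by have /interior_id -> : open (Omega° : set (R * R)) by exact: open_interior.
Qed.

Let u := cone_fun (Omega° : set (R * R)) a.

(** Shrinking towards the interior apex moves a point of the closure into the interior, so every
    [1 + e] is in the gauge set. *)
Lemma cone_fun_closure p : closure Omega p -> 0 <= u p.
Proof.
move=> Cp; rewrite /u /cone_fun subr_ge0; apply/ler_addgt0Pr => e e0.
apply: gauge_le; split; first by rewrite addr_gt0.
apply: convex_interior_segment => //.
by rewrite invr_ge0 addr_ge0 ?(ltW e0) //= invf_lt1 ?addr_gt0 // ltrDl.
Qed.

Lemma cone_fun_admissible : admissible Omega u.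
Proof.
have [r r0 rO] := interior_box; have cOm := interior_convex2.
split.
- by apply: continuous_subspaceT; exact: (cone_fun_continuous cOm r0 rO).
- apply: concave2_convex_function => p q t _ _.
  exact: (cone_fun_concave cOm r0 rO).
- move=> p [Cp nO]; apply/eqP; rewrite eq_le cone_fun_closure // andbT.
  exact: (cone_fun_out cOm aO r0 rO).
- exists (Num.sqrt (2 * (1 / r) ^+ 2)) => p _ /diff_derivable d.
  rewrite ler_wsqrtr // mulr_natl mulr2n lerD //.
    have := cone_fun_derive_bound cOm r0 rO (d (1, 0)).
    rewrite /norm1 /= normr1 normr0 addr0 => h.
    by rewrite -[X in X <= _]real_normK ?num_real // lerXn2r ?nnegrE // divr_ge0 // ltW.
  have := cone_fun_derive_bound cOm r0 rO (d (0, 1)).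
  rewrite /norm1 /= normr1 normr0 add0r => h.
  by rewrite -[X in X <= _]real_normK ?num_real // lerXn2r ?nnegrE // divr_ge0 // ltW.
Qed.

End cone_admissible.

(** * Energies of the cones *)

Section steep.
Variables (R : realType) (Omega : set (R * R)).
Hypotheses (bO : bounded_set Omega) (cO : convex_set Omega).
Implicit Types (p q z : R * R).
Let Om : set (R * R) := Omega°.
Let C : set (R * R) := closure Omega.
Local Notation mu := (@lebesgue_measure R).

Let oOm : open Om.
Proof. exact: open_interior. Qed.

Let c2O : convex2 Omega.
Proof. exact: convex_set_convex2. Qed.

Let mOm : measurable Om.
Proof. exact: open_measurable2. Qed.

Lemma lebesgue2_interior_lty : (@lebesgue2 R Om < +oo)%E.
Proof.
have [M M0 hM] := bounded_set_box bO.
pose I : set R := `[- M, M]%classic.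
have mI : measurable (I `*` I) by apply: measurableX; exact: measurable_itv.
apply: (@le_lt_trans _ _ (@lebesgue2 R (I `*` I))).
  apply: le_measure; rewrite ?inE //; move=> p /interior_subset_closure/hM[].
  by rewrite !ler_norml => h1 h2; split; rewrite /I /= in_itv.
have -> : @lebesgue2 R (I `*` I) = (mu I * mu I)%E.
  by apply: product_measure1E; exact: measurable_itv.
rewrite lebesgue_measure_itv /=.
by case: ifPn => _; rewrite ?mule0 ?ltry // -EFinD -EFinM ltry.
Qed.

Section apex.
Variable a : R * R.
Hypothesis aO : Om a.
Let u := cone_fun Om a.
Let U := zero_ext Omega u.

Lemma apex_admissible : admissible Omega u.
Proof. exact: cone_fun_admissible. Qed.

Let au := apex_admissible.
Let ctU : continuous U.
Proof. exact: (zero_ext_continuous au). Qed.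
Let cU : concave2 C U.
Proof. exact: (zero_ext_concave cO au). Qed.
Let OC : Om `<=` C.
Proof. exact: (@interior_subset_closure R Omega). Qed.
Let cUO : concave2 Om U.
Proof. by move=> p q t /OC Cp /OC Cq; exact: cU. Qed.
Let U0 p : ~ Om p -> U p = 0.
Proof. exact: zero_ext_out. Qed.
Let Uge0 p : 0 <= U p.
Proof. exact: (zero_ext_ge0 bO cO au). Qed.
Let Uu p : Om p -> U p = u p.
Proof. exact: zero_ext_in. Qed.

(** Testing the tangent plane at [a] would only bound it from below. Its upper bound 1 there comes
    from a test slightly beyond [q] on the ray from [a], where [cone_fun_ray] limits the decrease;
    with [0 <= U z] the values at [z] and [a] differ by at least [-1]. *)
Lemma apex_supergradient q z : Om q -> C z ->
  derivable U q (dir R true) -> derivable U q (dir R false) ->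
  -1 <= 'D_(dir R true) U q * (z.1 - a.1) + 'D_(dir R false) U q * (z.2 - a.2).
Proof.
move=> Oq Cz dx dy.
have [r r0 rO] := interior_box aO; have cOm := interior_convex2 c2O.
have [e e0 eO] := open_segment_near (q - a) oOm Oq.
pose h := e / 2; have h0 : 0 < h by rewrite divr_gt0.
have Oh : Om (q + h *: (q - a)) by apply: eO; rewrite (gtr0_norm h0) ltr_pdivrMr // ltr_pMr // ltr1n.
have Sz := supergradient oOm OC cU Oq Cz dx dy.
have Sh := supergradient oOm OC cU Oq (OC Oh) dx dy.
have ray := cone_fun_ray r0 rO q (ltW h0).
rewrite (Uu Oh) (Uu Oq) /u in Sh; rewrite (Uu Oq) /u in Sz.
have := le_trans ray Sh; move: Sz; have := Uge0 z => {Sh ray}.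
have -> : (q + h *: (q - a)).1 - q.1 = h * (q.1 - a.1) by rewrite /=; scale_mul; ring.
have -> : (q + h *: (q - a)).2 - q.2 = h * (q.2 - a.2) by rewrite /=; scale_mul; ring.
move: ('D_(dir R true) U q) ('D_(dir R false) U q) (cone_fun Om a q) => ux uy x Uz Sz H.
have : h * (ux * (a.1 - q.1) + uy * (a.2 - q.2)) <= h * (1 - x) by lra.
rewrite ler_pM2l //; lra.
Qed.

(** Needed for the quotient, since [+oo / +oo] is [0] in the extended reals. The gradient is bounded
    and [Om] has finite area. *)
Lemma apex_energy_lty : (energy Om U true < +oo)%E.
Proof.
have [r r0 rO] := interior_box aO; have cOm := interior_convex2 c2O.
have L := lebesgue2_interior_lty.
apply: (@le_lt_trans _ _ (\int[@lebesgue2 R]_(p in Om) ((1 / r) ^+ 2)%:E)%E).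
  apply: ae_ge0_le_integral => //.
  - by move=> p _; rewrite lee_fin sqr_ge0.
  - exact: (measurable_energy oOm OC ctU cU true).
  - by move=> p _; rewrite lee_fin sqr_ge0.
  have FF := ae_filter_ringOfSetsType (@lebesgue2 R : {measure set _ -> \bar R}).
  have AE := @ae_derivable R Om C U oOm OC ctU cU true.
  apply: (@filterS _ _ FF _ _ _ AE) => p dU Op.
  rewrite lee_fin -(@zero_ext_derive R Omega u p (dir R true) Op).
  have du : derivable u p (dir R true).
    apply: near_eq_derivable (dU Op).
    by apply: (filterS _ (open_nbhs_nbhs (conj oOm Op))) => q Oq; exact: Uu.
  have := cone_fun_derive_bound cOm r0 rO du.
  rewrite /norm1 /= normr1 normr0 addr0 => h.
  by rewrite -[X in X <= _]real_normK ?num_real // lerXn2r ?nnegrE // divr_ge0 // ltW.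
rewrite integral_cst //; apply: lte_mul_pinfty => //.
by rewrite lee_fin sqr_ge0.
Qed.

(** The tests at [xi] and [P] give [|u_y * Y| <= 1 + |u_x| * x]. Squaring yields
    [2 + 2 * u_x ^ 2 * x ^ 2], and [K * x < 2 * |Y|] turns the last term into
    [(8 / K ^ 2) * u_x ^ 2] after division by [Y ^ 2]. *)
Lemma apex_energy_y_le (xi P : R * R) (x Y K : R) : C xi -> C P -> 0 < K -> Y != 0 ->
  xi.2 - a.2 = - Y -> P.2 - a.2 = Y -> `|xi.1 - a.1| <= x -> `|P.1 - a.1| <= x ->
  K * x < 2 * `|Y| ->
  (energy Om U false <= (2 / Y ^+ 2)%:E * @lebesgue2 R Om + (8 / K ^+ 2)%:E * energy Om U true)%E.
Proof.
move=> Cxi CP K0 Yn xi2 P2 xi1 P1 KY.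
have Y20 : 0 < Y ^+ 2 by rewrite exprn_even_gt0.
have K20 : 0 < K ^+ 2 by rewrite exprn_gt0.
have x0 : 0 <= x by exact: le_trans xi1.
have c1 : 0 <= 2 / Y ^+ 2 by rewrite divr_ge0 // ltW.
have c2 : 0 <= 8 / K ^+ 2 by rewrite divr_ge0 // ltW.
have mE b := measurable_energy oOm OC ctU cU b.
have mE2 : measurable_fun Om (fun p => (8 / K ^+ 2)%:E * (('D_(dir R true) U p) ^+ 2)%:E)%E.
  by apply: emeasurable_funM => //; exact: mE.
have g0 p : (0 <= (8 / K ^+ 2)%:E * (('D_(dir R true) U p) ^+ 2)%:E)%E.
  by rewrite mule_ge0 // lee_fin // sqr_ge0.
rewrite -integral_cst // -ge0_integralZl //; first last.
- by move=> p _; rewrite lee_fin sqr_ge0.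
- exact: mE.
rewrite -ge0_integralD //.
apply: ae_ge0_le_integral => //.
- by move=> p _; rewrite lee_fin sqr_ge0.
- exact: (mE false).
- by move=> p _; apply: adde_ge0; [rewrite lee_fin|exact: g0].
- by apply: emeasurable_funD.
have FF := ae_filter_ringOfSetsType (@lebesgue2 R : {measure set _ -> \bar R}).
have AE b := @ae_derivable R Om C U oOm OC ctU cU b.
apply: (@filterS2 _ _ FF _ _ _ _ (AE true) (AE false)) => q dx dy Oq.
rewrite -EFinM -EFinD lee_fin.
have S1 := apex_supergradient Oq Cxi (dx Oq) (dy Oq).
have S2 := apex_supergradient Oq CP (dx Oq) (dy Oq).
rewrite xi2 in S1; rewrite P2 in S2.
move: S1 S2; move: ('D_(dir R true) U q) ('D_(dir R false) U q) => ux uy S1 S2.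
have b (v : R) : `|v| <= x -> ux * v <= `|ux| * x.
  by move=> vx; apply: (le_trans (ler_norm _)); rewrite normrM ler_wpM2l.
have B1 := b _ xi1; have B2 := b _ P1.
have H : `|uy * Y| <= 1 + `|ux| * x by rewrite ler_norml; apply/andP; split; lra.
have H2 : (uy * Y) ^+ 2 <= (1 + `|ux| * x) ^+ 2.
  rewrite -[X in X <= _]real_normK ?num_real // lerXn2r ?nnegrE //.
  by rewrite addr_ge0 // mulr_ge0.
have H3 : (K * x) ^+ 2 <= 4 * Y ^+ 2.
  have -> : 4 * Y ^+ 2 = (2 * `|Y|) ^+ 2 by rewrite exprMn real_normK ?num_real //; ring.
  by rewrite lerXn2r ?nnegrE ?(ltW KY) ?mulr_ge0 ?(ltW K0).
have H4 : (1 + `|ux| * x) ^+ 2 <= 2 + 2 * ux ^+ 2 * x ^+ 2.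
  have <- : `|ux| ^+ 2 = ux ^+ 2 by rewrite real_normK ?num_real.
  have := sqr_ge0 (1 - `|ux| * x); lra.
have H5 : ux ^+ 2 * (K * x) ^+ 2 <= ux ^+ 2 * (4 * Y ^+ 2) by rewrite ler_wpM2l // sqr_ge0.
rewrite -(ler_pM2l (mulr_gt0 K20 Y20)).
have -> : K ^+ 2 * Y ^+ 2 * (2 / Y ^+ 2 + 8 / K ^+ 2 * ux ^+ 2) =
   2 * K ^+ 2 + 8 * ux ^+ 2 * Y ^+ 2 by field; rewrite Yn gt_eqF.
have : K ^+ 2 * (uy * Y) ^+ 2 <= K ^+ 2 * (2 + 2 * ux ^+ 2 * x ^+ 2).
  by rewrite ler_pM2l //; exact: le_trans H4.
rewrite !exprMn in H5 *; lra.
Qed.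

(* The dyadic strips are those where the height of [q_t = a + t *: (xi - a)]
   is at [t] between [2^-(k+2)] and [2^-(k+1)]; each contributes the same
   amount to the energy. *)
Lemma apex_energy_x_ge (xi : R * R) (s Y w d : R) n : C xi -> (s = 1 \/ s = -1) -> Y != 0 ->
  xi.2 - a.2 = - Y -> 0 < w -> 0 < d -> d <= w / 2 ^+ n ->
  (forall t, 0 < t < 1 / 2 ->
     ~ Om (a.1 + t * (xi.1 - a.1) - s * (d + 2 * t * w), a.2 - t * Y)) ->
  ((n%:R * (`|Y| / (24 * w)))%:E <= energy Om U true)%E.
Proof.
move=> Cxi s1 Yn xi2 w0 d0 dn out.
have [r r0 rO] := interior_box aO; have cOm := interior_convex2 c2O.
have mE := measurable_energy oOm OC ctU cU true.
have E0 p : Om p -> (0 <= (('D_(dir R true) U p) ^+ 2)%:E)%E by rewrite lee_fin sqr_ge0.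
have [mS ES] := integral_slices true mOm mE E0.
rewrite /energy ES.
have S0 y : (0 <= slice_integral Om true (fun p => (('D_(dir R true) U p) ^+ 2)%:E) y)%E.
  by apply: integral_ge0 => t /E0.
pose J k := step a.2 (- (Y / 2 ^+ k.+2)) 1.
have p2 k : 0 < 2 ^+ k :> R by rewrite exprn_gt0.
have half k : 2 / 2 ^+ k.+2 = (2 ^+ k.+1)^-1 :> R.
  by rewrite [2 ^+ k.+2]exprS; field; rewrite gt_eqF.
have dk k : - (Y / 2 ^+ k.+2) != 0 by rewrite oppr_eq0 mulf_neq0 // invr_neq0 // gt_eqF.
have Jt k y : J k y -> exists2 t, y = a.2 - t * Y & (2 ^+ k.+2)^-1 < t < 2 / 2 ^+ k.+2.
  move=> /andP[h1 h2]; pose v := (y - a.2) / - (Y / 2 ^+ k.+2).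
  exists (v / 2 ^+ k.+2).
    by rewrite /v; field; rewrite Yn gt_eqF.
  by rewrite -[X in X < _ < _]mul1r !ltr_pM2r ?invr_gt0 //; apply/andP.
have -> : n%:R * (`|Y| / (24 * w)) = \sum_(i < n) `|Y| / (24 * w).
  by rewrite sumr_const card_ord mulr_natl.
apply: (@integral_ge_sum R setT J _ (fun=> `|Y| / (24 * w)) n) => //.
- by move=> k; have [] := step_measure a.2 1 (dk k).
- apply/trivIsetP => i j _ _; wlog lt : i j / (i < j)%N.
    move=> H; rewrite neq_ltn => /orP[lt|lt]; first by apply: H => //; rewrite neq_ltn lt.
    by rewrite setIC; apply: H => //; rewrite neq_ltn lt.
  move=> _; apply/seteqP; split => // y [/Jt[t -> /andP[t1 _]] /Jt[t' e /andP[_ t2]]].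
  have tt : t = t' by apply: (mulIf Yn); move: e; lra.
  rewrite -tt in t2; have := lt_trans t1 t2.
  rewrite half ltf_pV2 ?posrE // ltr_eXn2l; last by rewrite ltr1n.
  by rewrite !ltnS leqNgt lt.
- move=> k kn; have [mJ Jm] := step_measure a.2 1 (dk k).
  (* At [q] concavity from the apex gives [U >= 1 / 2], and a point outside [Om] lies at distance
     [d + 2 * t * w], at most [3 * w * (2 / 2 ^+ k.+2)]. The strip has height [|Y| / 2 ^+ k.+2], so
     [k] cancels and [|Y| / (24 * w)] remains. *)
  have := @integral_ge_cst R (J k) set0 (slice_integral Om true (fun p => (('D_(dir R true) U p) ^+ 2)%:E))
    ((1 / 4) / (3 * w * (2 / 2 ^+ k.+2))) _ mJ Jm.
  have -> : (1 / 4) / (3 * w * (2 / 2 ^+ k.+2)) * `|- (Y / 2 ^+ k.+2)| = `|Y| / (24 * w).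
    by rewrite normrN normrM normfV (gtr0_norm (p2 _)); field; rewrite !gt_eqF.
  apply => //; first exact: measurable_funTS.
  move=> y /Jt[t -> /andP[t1 t2]] _.
  have t0 : 0 < t by apply: lt_trans t1; rewrite invr_gt0.
  have th : t < 1 / 2.
    apply: (lt_le_trans t2); rewrite half mul1r lef_pV2 ?posrE //.
    by rewrite exprS ler_peMr // exprn_ege1 // ler1n.
  pose q := a + t *: (xi - a).
  have Oq : Om q by apply: convex_interior_segment => //; apply/andP; split; [exact: ltW|lra].
  have eq : q = pt true (a.2 - t * Y) (a.1 + t * (xi.1 - a.1)).
    by rewrite /q; pair_eq => //; rewrite xi2 mulrN.
  have uq : 1 / 2 <= U q.
    have t01 : 0 <= t <= 1 by apply/andP; split; lra.
    have := cU (OC aO) Cxi t01; rewrite -/q (Uu aO) /u (cone_fun_apex r0 rO).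
    move: (U xi) (U q) (Uge0 xi) => m m' m0.
    have := mulr_ge0 (ltW t0) m0; lra.
  have nOw : ~ Om (pt true (a.2 - t * Y) (a.1 + t * (xi.1 - a.1) - s * (d + 2 * t * w))).
    by apply: out; rewrite t0.
  rewrite eq in Oq uq; have := slice_energy_ge oOm cUO ctU U0 Oq nOw (Uge0 _).
  have D0 : 0 < d + 2 * t * w by rewrite addr_gt0 // !mulr_gt0.
  have -> : `|a.1 + t * (xi.1 - a.1) - (a.1 + t * (xi.1 - a.1) - s * (d + 2 * t * w))| = d + 2 * t * w.
    have -> : a.1 + t * (xi.1 - a.1) - (a.1 + t * (xi.1 - a.1) - s * (d + 2 * t * w)) =
      s * (d + 2 * t * w) by ring.
    by rewrite normrM (gtr0_norm D0); case: s1 => ->; rewrite ?normrN normr1 mul1r.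
  apply: le_trans; rewrite lee_fin.
  (* Here [k < n] is used: [d <= w / 2 ^+ n] is at most [w / 2 ^+ k.+1]. *)
  have d2 : d <= w * (2 / 2 ^+ k.+2).
    apply: (le_trans dn); rewrite ler_pM2l // half.
    by rewrite lef_pV2 ?posrE // ler_weXn2l // ler1n.
  have tw : t * w <= w * (2 / 2 ^+ k.+2) by rewrite mulrC ler_pM2l // ltW.
  apply: ler_pM; rewrite ?invr_ge0 //; first last.
  - by rewrite lef_pV2 ?posrE //; [lra|rewrite !mulr_gt0 // invr_gt0].
  - nra.
  - by rewrite !mulr_ge0 ?invr_ge0 // ltW.
Qed.

End apex.
End steep.

(** * Proof of the theorem *)

Section main.
Variables (R : realType) (Omega : set (R * R)).
Hypotheses (bO : bounded_set Omega) (cO : convex_set Omega).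
Implicit Types (p q xi : R * R).
Let Om : set (R * R) := Omega°.

(** Here [w] is the distance from [p] to the exit point in the direction of the line. By convexity
    no point of the interior at this height lies at or beyond the exit. *)
Lemma horizontal_exit p (c : R) (sg : bool) : Om p ->
  (forall q, closure Omega q -> 0 <= (-1) ^+ sg * (q.1 - c)) ->
  exists w : R, [/\ 0 < w, w <= (-1) ^+ sg * (p.1 - c),
    forall v, 0 <= v < w -> Om (p.1 - (-1) ^+ sg * v, p.2) &
    forall x, Om (x, p.2) -> 0 < (-1) ^+ sg * (x - p.1) + w].
Proof.
move=> Op side; set s : R := (-1) ^+ sg; set h := s * (p.1 - c).
have ss : s * s = 1 by rewrite /s -signr_addb addbb.
have h0 : 0 <= h by apply: side; exact: interior_subset_closure.
have oOm : open Om by exact: open_interior.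
have h1 : 0 < 1 + h by rewrite ltr_wpDr.
pose q := (p.1 - s * (1 + h), p.2).
have nOq : ~ Om q.
  move/interior_subset_closure/side; rewrite -/s /q /=.
  have -> : s * (p.1 - s * (1 + h) - c) = h - (s * s) * (1 + h) by rewrite /h; ring.
  by rewrite ss; lra.
have [r [/andP[r0 r1] nO inO]] := first_exit oOm Op nOq.
have E v : p + v *: (q - p) = (p.1 - s * (v * (1 + h)), p.2).
  by rewrite /q; pair_eq; ring.
rewrite E in nO; pose w := r * (1 + h); have w0 : 0 < w by exact: mulr_gt0.
have ins v : 0 <= v < w -> Om (p.1 - s * v, p.2).
  move=> /andP[v0 vw]; have := inO (v / (1 + h)); rewrite E divfK ?gt_eqF //; apply.
  by rewrite divr_ge0 ?(ltW h1) //= ltr_pdivrMr.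
exists w; split => //.
  rewrite leNgt; apply/negP => hw; have /ins : 0 <= (h + w) / 2 < w by apply/andP; split; lra.
  move/interior_subset_closure/side; rewrite -/s /=.
  have -> : s * (p.1 - s * ((h + w) / 2) - c) = h - (s * s) * ((h + w) / 2) by rewrite /h; ring.
  by rewrite ss; lra.
move=> x Ox; rewrite ltNge; apply/negP => xw; apply: nO.
pose v := s * (p.1 - x); have wv : w <= v by rewrite /v; lra.
have v0 : 0 < v by exact: lt_le_trans wv.
have t01 : 0 <= w / v <= 1 by rewrite divr_ge0 ?(ltW w0) ?(ltW v0) //= ler_pdivrMr // mul1r.
have := interior_convex2 (convex_set_convex2 cO) Op Ox t01; congr Om.
pair_eq; last by ring.
have -> : x - p.1 = - (s * v) by rewrite /v mulrA ss; ring.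
by rewrite -/w; field; rewrite gt_eqF.
Qed.

(** The constant [c1] is chosen before [X], so making [energy_x] large leaves only the factor
    [8 / K ^+ 2]. *)
Lemma steep_family (c : R) (sg : bool) (xi P : R * R) (K : R) :
  (forall q, closure Omega q -> 0 <= (-1) ^+ sg * (q.1 - c)) ->
  closure Omega xi -> xi.1 = c -> Om P -> 0 < K ->
  K * `|P.1 - c| < `|P.2 - xi.2| ->
  exists2 c1 : R, 0 <= c1 & forall X : R, exists u,
    [/\ admissible Omega u, exists2 p, Omega p & u p != 0,
        (X%:E <= energy_x Omega u < +oo)%E &
        (energy_y Omega u <= c1%:E + (8 / K ^+ 2)%:E * energy_x Omega u)%E].
Proof.
move=> side Cxi xic OP K0 steep.
have c2O := convex_set_convex2 cO.
pose M : R * R := P + 2^-1 *: (xi - P).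
have OM : Om M.
  by apply: convex_interior_segment => //; rewrite invr_ge0 ler0n invf_lt1 // ltr1n.
have [w [w0 wh ins excl]] := horizontal_exit OM side.
have CP : closure Omega P by exact: interior_subset_closure.
move: wh ins excl (side _ CP); set s : R := (-1) ^+ sg => wh ins excl sideP.
have s1 : s = 1 \/ s = -1 by rewrite /s; case: (sg); [right|left].
have ss : s * s = 1 by case: s1 => ->; ring.
have sn x : `|s * x| = `|x| by rewrite normrM; case: s1 => ->; rewrite ?normrN normr1 mul1r.
pose h := s * (P.1 - c) / 2; have h0 : 0 <= h by rewrite divr_ge0.
have M1 : M.1 = c + s * h.
  have -> : s * h = (s * s) * ((P.1 - c) / 2) by rewrite /h; ring.
  by rewrite ss /M /=; scale_mul; rewrite xic; field.
have P1 : P.1 = c + s * (2 * h).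
  have -> : s * (2 * h) = (s * s) * (P.1 - c) by rewrite /h; field.
  by rewrite ss; ring.
clearbody h.
have wh' : w <= h.
  move: wh; rewrite M1; have -> : s * (c + s * h - c) = (s * s) * h by ring.
  by rewrite ss mul1r.
pose Y := (P.2 - xi.2) / 2.
have M2 : M.2 = (P.2 + xi.2) / 2 by rewrite /M /=; scale_mul; field.
clearbody M.
have x2 : `|P.1 - c| = 2 * h.
  have -> : P.1 - c = s * (2 * h) by rewrite {1}P1; ring.
  by rewrite sn ger0_norm // mulr_ge0.
rewrite x2 in steep.
have Yabs : `|P.2 - xi.2| = 2 * `|Y|.
  by rewrite /Y normrM [`|2^-1|]gtr0_norm ?invr_gt0 //; field.
rewrite Yabs in steep.
have Y0 : 0 < `|Y|.
  have Kh : 0 <= K * (2 * h) by rewrite !mulr_ge0 // ltW.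
  lra.
have Yn : Y != 0 by rewrite -normr_gt0.
have Lfin := lebesgue2_interior_lty bO.
have Lge : (0 <= @lebesgue2 R Om)%E by exact: measure_ge0.
pose L := fine (@lebesgue2 R Om).
have LE : @lebesgue2 R Om = L%:E by rewrite /L fineK // ge0_fin_numE.
have L0 : 0 <= L by rewrite -lee_fin -LE.
exists (2 / Y ^+ 2 * L); first by rewrite mulr_ge0 // divr_ge0 // sqr_ge0.
move=> X.
have [n hn] : exists n : nat, X <= n%:R * (`|Y| / (24 * w)).
  have k0 : 0 < `|Y| / (24 * w) by rewrite divr_gt0 // mulr_gt0.
  exists (Num.bound `|X / (`|Y| / (24 * w))|); rewrite -ler_pdivrMr //.
  by apply: (le_trans (ler_norm _)); apply: ltW; exact: archi_boundP.
pose d := w / 2 ^+ n.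
have d0 : 0 < d by rewrite divr_gt0 // exprn_gt0.
have dw : d <= w by rewrite ler_pdivrMr ?exprn_gt0 // ler_peMr ?(ltW w0) // exprn_ege1 // ler1n.
(* The apex is at distance [d] from the exit point [M.1 - s * w] of the horizontal line through
   [M]. *)
pose a : R * R := (M.1 - s * (w - d), M.2).
have Oa : Om a by apply: ins; apply/andP; split; lra.
have a1 : a.1 = c + s * (h - (w - d)) by rewrite /a /= M1; ring.
have xi1 : `|xi.1 - a.1| <= 2 * h.
  rewrite a1 xic; have -> : c - (c + s * (h - (w - d))) = s * - (h - (w - d)) by ring.
  by rewrite sn normrN ger0_norm; lra.
have Pa1 : `|P.1 - a.1| <= 2 * h.
  rewrite a1 P1; have -> : c + s * (2 * h) - (c + s * (h - (w - d))) = s * (h + (w - d)) by ring.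
  by rewrite sn ger0_norm; lra.
have xi2 : xi.2 - a.2 = - Y by rewrite /a /= M2 /Y; field.
have P2 : P.2 - a.2 = Y by rewrite /a /= M2 /Y; field.
have a2 : a.2 = M.2 by [].
clearbody a.
have au := apex_admissible cO Oa.
exists (cone_fun Om a); split => //.
- have [r r0 rO] := interior_box Oa.
  exists a; first exact: interior_subset.
  by rewrite (cone_fun_apex r0 rO) oner_eq0.
- rewrite energy_x_ext; apply/andP; split; last exact: apex_energy_lty.
  apply: (@le_trans _ _ (n%:R * (`|Y| / (24 * w)))%:E); first by rewrite lee_fin.
  apply: (apex_energy_x_ge (d := d) bO cO Oa Cxi s1 Yn xi2 w0 d0) => // t /andP[t0 t1] Oz.
  (* The segment from [z] to [P] crosses the height of [a] at distance [d * t / (1 + t)] beyond the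
     exit point, so [z] cannot be in [Om]. *)
  move: Oz; set z := (_, _) => Oz.
  have tt : 0 <= t / (1 + t) <= 1.
    by rewrite divr_ge0 ?(ltW t0) ?addr_ge0 ?(ltW t0) //= ler_pdivrMr ?mul1r; lra.
  have t10 : 1 + t != 0 by rewrite gt_eqF // addr_gt0.
  have := interior_convex2 c2O Oz OP tt.
  have -> : z + (t / (1 + t)) *: (P - z) = ((z.1 + t * P.1) / (1 + t), M.2).
    rewrite /z; pair_eq; first by field.
    by rewrite -[P.2](subrK a.2) P2 -a2; field.
  move/excl.
  have -> : s * ((z.1 + t * P.1) / (1 + t) - M.1) + w = - (d * t) / (1 + t) * (s * s) + w * (1 - s * s).
    by rewrite /z /= a1 xic P1 M1; case: s1 => ->; field.
  rewrite ss subrr mulr0 addr0 mulr1 ltNge => /negP; apply.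
  by rewrite mulNr oppr_le0 divr_ge0 ?mulr_ge0 ?ltW // addr_gt0.
- rewrite energy_y_ext energy_x_ext EFinM -LE.
  exact: (apex_energy_y_le bO cO Oa Cxi CP K0 Yn xi2 P2 xi1 Pa1 steep).
Qed.

(** The steepness is a strict inequality, so it survives a small move towards an interior point. *)
Lemma steep_interior_point (c : R) xi (K : R) p : Om !=set0 -> Omega p ->
  K * `|p.1 - c| < `|p.2 - xi.2| -> 0 < K ->
  exists2 P, Om P & K * `|P.1 - c| < `|P.2 - xi.2|.
Proof.
move=> [z Oz] Op lt K0.
(* Moving by the fraction [t] costs less than [t * D] of the gap [g]. *)
pose D := K * `|z.1 - p.1| + `|z.2 - p.2| + 1.
have D0 : 0 < D by rewrite ltr_wpDl // addr_ge0 // mulr_ge0 // ltW.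
pose g := `|p.2 - xi.2| - K * `|p.1 - c|; have g0 : 0 < g by rewrite subr_gt0.
pose t := g / (D + g); have Dg : 0 < D + g by exact: addr_gt0.
have t0 : 0 < t by exact: divr_gt0.
have t1 : t <= 1 by rewrite ler_pdivrMr // mul1r lerDr ltW.
have tD : t * D < g.
  by rewrite /t mulrAC ltr_pdivrMr // ltr_pM2l // ltrDl.
exists (z + (1 - t) *: (p - z)).
  apply: convex_interior_segment => //; first exact: convex_set_convex2.
    exact: subset_closure.
  by apply/andP; split; lra.
have -> : (z + (1 - t) *: (p - z)).1 - c = p.1 - c + t * (z.1 - p.1) by rewrite /=; scale_mul; ring.
have -> : (z + (1 - t) *: (p - z)).2 - xi.2 = p.2 - xi.2 - t * - (z.2 - p.2) by rewrite /=; scale_mul; ring.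
have n1 : `|p.1 - c + t * (z.1 - p.1)| <= `|p.1 - c| + t * `|z.1 - p.1|.
  by rewrite (le_trans (ler_normD _ _)) // normrM (gtr0_norm t0).
have n2 : `|p.2 - xi.2| - t * `|z.2 - p.2| <= `|p.2 - xi.2 - t * - (z.2 - p.2)|.
  by rewrite (le_trans _ (lerB_dist _ _)) // normrM normrN (gtr0_norm t0).
have : K * `|p.1 - c + t * (z.1 - p.1)| <= K * (`|p.1 - c| + t * `|z.1 - p.1|).
  by rewrite ler_pM2l.
move: tD; rewrite /D /g; lra.
Qed.

Lemma infinite_ratio c : Om !=set0 -> support_line Omega (vertical_line c) ->
  ~ angular Omega (vertical_line c) -> sup_energy_ratio Omega = +oo%E.
Proof.
move=> O0 sl na; have [sg side [xi Cxi xic]] := support_vertical_side sl.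
have Omega0 : Omega !=set0 by have [z /interior_subset] := O0; exists z.
(* This [K] makes [B * (8 / K ^+ 2) <= 1 / 2], and [energy_x >= 2 * B * c1 + 1] absorbs the constant
   term into the other half. *)
apply/eqyP => B B0; pose K := 4 * (B + 1); have K0 : 0 < K by rewrite mulr_gt0 // addr_gt0.
have [p Op lt] := not_angular_steep Omega0 sl na side Cxi xic K0.
have [P OP {}lt] := steep_interior_point O0 Op lt K0.
have [c1 c10 H] := steep_family side Cxi xic OP K0 lt.
have [u [au [q Oq uq] /andP[X1 X2] ey]] := H (2 * B * c1 + 1).
apply: (@le_trans _ _ (energy_x Omega u / energy_y Omega u)%E); last first.
  by apply: ereal_sup_ubound; exists u => //; split => //; exists q.
have y0 : (0 <= energy_y Omega u)%E by apply: integral_ge0 => z _; rewrite lee_fin sqr_ge0.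
move: X1 X2 ey y0; case: (energy_x Omega u) => [e||] //.
rewrite lee_fin => e1 _; case: (energy_y Omega u) => [f||] //.
rewrite -EFinM -EFinD !lee_fin => fe f0.
have e0 : 0 < e by apply: lt_le_trans e1; rewrite ltr_wpDl // !mulr_ge0 // ltW.
(* The inverse of [0] is [+oo], so a vanishing [energy_y] makes the quotient [+oo]. *)
have [f00|fn] := eqVneq f 0.
  by rewrite f00 inver eqxx gt0_muley ?leey // lte_fin.
rewrite inver (negbTE fn) -EFinM lee_fin ler_pdivlMr; last by rewrite lt_neqAle eq_sym fn.
have B1 : 0 < B + 1 by rewrite addr_gt0.
have kB : B * (8 / K ^+ 2) <= 1 / 2.
  have -> : B * (8 / K ^+ 2) = B / (2 * (B + 1) ^+ 2) by rewrite /K; field; rewrite gt_eqF.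
  rewrite ler_pdivrMr ?mulr_gt0 ?exprn_gt0 //; nra.
have : B * f <= B * (c1 + 8 / K ^+ 2 * e) by rewrite ler_pM2l.
have : B * (8 / K ^+ 2) * e <= 1 / 2 * e by rewrite ler_wpM2r // ltW.
lra.
Qed.

Lemma finite_ratio : Om !=set0 ->
  (forall c, support_line Omega (vertical_line c) -> angular Omega (vertical_line c)) ->
  (sup_energy_ratio Omega < +oo)%E.
Proof.
move=> O0 ang; have Omega0 : Omega !=set0 by have [z /interior_subset] := O0; exists z.
have side_cone (sg : bool) : exists2 xi, boundary Omega xi & exists2 K : R, 0 < K &
    forall p, Omega p -> `|p.2 - xi.2| <= K * ((-1) ^+ sg * (p.1 - xi.1)).
  have [z Cz side] := horizontal_extreme sg bO Omega0.
  have [xi [bxi xiz] [K K0 cone]] := angular_cone (ang _ (vertical_side_support Cz side)).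
  exists xi => //; exists K => // p Op; apply: (le_trans (cone _ Op)).
  rewrite ler_pM2l // xiz -(ger0_norm (side _ (subset_closure Op))).
  by rewrite normrM normr_sign mul1r.
have [xi bxi [K1 K10 cone1]] := side_cone false.
have [eta beta [K2 K20 cone2]] := side_cone true.
pose K := Num.max K1 K2; have K0 : 0 < K by rewrite lt_max K10.
apply: (@le_lt_trans _ _ (39 * K ^+ 2)%:E); last by rewrite ltry.
apply: ge_ereal_sup => _ [u [au _] <-].
apply: div_le_of_le_mul.
- by rewrite mulr_ge0 // sqr_ge0.
- by apply: integral_ge0 => z _; rewrite lee_fin sqr_ge0.
- by apply: integral_ge0 => z _; rewrite lee_fin sqr_ge0.
rewrite energy_x_ext energy_y_ext.
have ext0 z : boundary Omega z -> zero_ext Omega u z = 0 by case=> _ nO; exact: zero_ext_out.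
have weaken K' x y : 0 < K' -> K' <= K -> 0 <= x -> x <= K' * y -> x <= K * y.
  move=> K'0 K'K x0 h; have y0 : 0 <= y by rewrite -(pmulr_rge0 y K'0) (le_trans x0).
  by apply: (le_trans h); rewrite ler_wpM2r.
apply: (@energy_bound R Om (closure Omega) _ (open_interior _) (@interior_subset_closure R Omega)
  (zero_ext_continuous au) (zero_ext_concave cO au) (@zero_ext_out R Omega u)
  (zero_ext_ge0 bO cO au) K xi eta) => //.
- by case: bxi.
- by case: beta.
- exact: ext0.
- exact: ext0.
- move=> p /interior_subset/cone1; rewrite expr0 mul1r; apply: weaken => //.
  by rewrite le_max lexx.
- move=> p /interior_subset/cone2; rewrite expr1 mulN1r opprB; apply: weaken => //.
  by rewrite le_max lexx orbT.
Qed.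

End main.

Theorem theorem1 (R : realType) (Omega : set (R * R))
    (bounded_Omega : bounded_set Omega)
    (convex_Omega : convex_set Omega)
    (interior_Omega : Omega° !=set0) :
  ((exists c : R, support_line Omega (vertical_line c) /\
                  ~ angular Omega (vertical_line c)) ->
     sup_energy_ratio Omega = +oo%E) /\
  ((forall c : R, support_line Omega (vertical_line c) ->
                  angular Omega (vertical_line c)) ->
     (sup_energy_ratio Omega < +oo)%E).
Proof.
split; last exact: finite_ratio.
by move=> [c [sl na]]; exact: infinite_ratio sl na.
Qed.
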